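(* For every $2<p<\infty$ and every integer $n\ge 2$, $\mathrm{SEP}^n(L_p)$ is bounded above and below by positive multiples, depending only on $p$, of $\sqrt{\log n}$. More precisely, there are universal constants $c,C>0$ such that for every $p\in(2,\infty)$ and every $n\in\mathbb N$, $$c\sqrt{\log n}\le \mathrm{SEP}^n(L_p)\le C\,p^2\sqrt{\log n}.$$
   Context: $L_p$ denotes the real Banach space $L_p([0,1])$ with Lebesgue measure. For a partition $\mathcal P$ of a metric space $(\mathcal M,d)$ and $x\in\mathcal M$, $\mathcal P(x)$ is the element of $\mathcal P$ containing $x$. A random partition $\mathcal P$ of $\mathcal M$ consists of a probability space $(\Omega,\mathbb P)$ and set-valued maps $\Gamma^1,\Gamma^2,\ldots:\Omega\to2^{\mathcal M}$ that are strongly measurable (for every $i$ and every closed $E\subseteq\mathcal M$, $\{\omega: E\cap\Gamma^i(\omega)\ne\emptyset\}$ is $\mathbb P$-measurable) such that for every $\omega$, $\mathcal P^\omega=\{\Gamma^k(\omega)\}_{k\in\mathbb N}$ is a partition of $\mathcal M$ (empty clusters allowed). (Measurability plays no role for finite $\mathcal M$.) For $\Delta>0$, it is $\Delta$-bounded if $\mathrm{diam}_{\mathcal M}(\mathcal P^\omega(x))\le\Delta$ for all $\omega\in\Omega$, $x\in\mathcal M$. For $\sigma\ge0$, a $\Delta$-bounded random partition is $\sigma$-separating if $\mathbb P[\mathcal P(x)\ne\mathcal P(y)]\le\frac{\sigma}{\Delta}d(x,y)$ for all $x,y\in\mathcal M$. $\mathrm{SEP}(\mathcal M)$ is the infimum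 over $\sigma\ge0$ such that for every $\Delta>0$ there is a $\Delta$-bounded $\sigma$-separating random partition of $\mathcal M$ ($\infty$ if no such $\sigma$ exists). $\mathrm{SEP}^n(\mathcal M)=\sup\{\mathrm{SEP}(\mathcal C):\ \mathcal C\subseteq\mathcal M,\ |\mathcal C|\le n\}$. *)

(* Defs.v *)
From HB Require Import structures.
From mathcomp Require Import all_boot all_order all_algebra.
From mathcomp Require Import all_classical all_reals all_analysis.
From mathcomp Require Import measurable_realfun.
Import Order.TTheory GRing.Theory Num.Theory.
Import numFieldNormedType.Exports.

Set Implicit Arguments.
Unset Strict Implicit.
Unset Printing Implicit Defensive.

Local Open Scope classical_set_scope.
Local Open Scope ring_scope.

Section SubsetMetric.
Context {R : realType} {M : metricType R} (A : set M).

Let sub_mdist (x y : A) : R := mdist (\val x) (\val y).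

Let sub_mdist_ge0 x y : 0 <= sub_mdist x y.
Proof. exact: mdist_ge0. Qed.

Let sub_mdist_positivity x y : sub_mdist x y = 0 -> x = y.
Proof. by move=> /mdist_positivity /val_inj. Qed.

Let ball_sub_mdist (x : A) (e : R) : ball x e = [set y | sub_mdist x y < e].
Proof.
by rewrite -initial_ballE ballEmdist.
Qed.

HB.instance Definition _ := @PseudoMetric_isMetric.Build R (set_type A)
  sub_mdist sub_mdist_ge0 sub_mdist_positivity ball_sub_mdist.

End SubsetMetric.

(* Lebesgue measure on [0, 1], carried by the whole of [R]: functions are
   identified when they agree almost everywhere on [0, 1]. *)
Definition leb01 (R : realType) :=
  mrestr (@lebesgue_measure R) (measurable_itv `[0%R, 1%R]).
Arguments leb01 R : clear implicits.
HB.instance Definition _ (R : realType) := Measure.on (leb01 R).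

Definition Lp (R : realType) (p : R) (p1 : (1 <= p%:E)%E) : Type :=
  LspaceType (leb01 R) p1.

Section LpMetric.
Context {R : realType} {p : R} {p1 : (1 <= p%:E)%E}.

HB.instance Definition _ := gen_eqMixin (Lp p1).
HB.instance Definition _ := gen_choiceMixin (Lp p1).

(* A representative of the class [f]. *)
Definition Lp_fun (f : Lp p1) : R -> R := f : LspaceType (leb01 R) p1.

Definition Lp_dist (f g : Lp p1) : R :=
  fine ('N[leb01 R]_(p%:E) [EFin \o (Lp_fun f \- Lp_fun g)%R])%E.

Fact measurable_Lp_fun f :
  measurable_fun [set: measurableTypeR R] (Lp_fun f).
Proof.
move=> mT Y mY.
exact: (@measurable_funPT _ _ _ _ (repr (LebesgueSpace.sort f))).
Qed.

Fact Lp_fun_inj f g : Lp_fun f = Lp_fun g %[ae leb01 R] -> f = g.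
Proof.
case: f => [f [[f0]]]; case: g => [g [[g0]]]; rewrite /Lp_fun /= => fg.
have fgE : f = g.
  rewrite -[f]reprK -[g]reprK; apply/eqmodP/asboolP.
  exact: fg.
move: f0 g0 fg; rewrite fgE => f0 g0 _.
by rewrite (Prop_irrelevance f0 g0).
Qed.

Fact Lp_distE f g :
  (Lp_dist f g)%:E = ('N[leb01 R]_(p%:E) [EFin \o (Lp_fun f \- Lp_fun g)%R])%E.
Proof.
rewrite /Lp_dist fineK// ge0_fin_numE ?Lnorm_ge0//.
have p0 : (0 < p%:E)%E by rewrite (lt_le_trans _ p1)// lte01.
apply: (@le_lt_trans _ _ ('N[leb01 R]_p%:E [EFin \o Lp_fun f] +
    'N[leb01 R]_p%:E [EFin \o (\- Lp_fun g)%R])%E).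
  apply: eminkowski => //; first exact: measurable_Lp_fun.
  by apply: measurableT_comp => //; exact: measurable_Lp_fun.
apply: lte_add_pinfty.
  exact: (@Lebesgue_finite _ _ _ _ _ _ f).
have -> : EFin \o (\- Lp_fun g)%R = (\- (EFin \o Lp_fun g))%E by [].
rewrite oppe_Lnorm.
exact: (@Lebesgue_finite _ _ _ _ _ _ g).
Qed.

Fact Lp_distxx f : Lp_dist f f = 0.
Proof.
rewrite /Lp_dist.
have -> : EFin \o (Lp_fun f \- Lp_fun f)%R = cst 0%E.
  by apply/funext => x /=; rewrite subrr.
by rewrite Lnorm0// gt_eqF// (lt_le_trans _ p1)// lte01.
Qed.

Fact Lp_dist_positivity f g : Lp_dist f g = 0 -> f = g.
Proof.
move=> d0; apply: Lp_fun_inj.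
have := Lp_distE f g; rewrite d0 => /esym/Lnorm_eq0_eq0.
have /measurable_EFinP mfg :
    measurable_fun [set: measurableTypeR R] (Lp_fun f \- Lp_fun g).
  by apply: measurable_funB; exact: measurable_Lp_fun.
move=> /(_ mfg (lt_le_trans lte01 p1)).
apply: filterS => x fg0 _; have [/eqP] := fg0 I.
by rewrite subr_eq0 => /eqP.
Qed.

Fact Lp_dist_sym f g : Lp_dist f g = Lp_dist g f.
Proof.
rewrite /Lp_dist -[in RHS]oppe_Lnorm; congr (fine (Lnorm _ _ _)).
by apply/funext => x /=; rewrite opprB.
Qed.

Fact Lp_dist_triangle g f h : Lp_dist f h <= Lp_dist f g + Lp_dist g h.
Proof.
rewrite -lee_fin EFinD !Lp_distE.
have -> : EFin \o (Lp_fun f \- Lp_fun h)%R =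
    EFin \o ((Lp_fun f \- Lp_fun g) \+ (Lp_fun g \- Lp_fun h))%R.
  by apply/funext => x /=; rewrite addrA subrK.
by apply: eminkowski => //; apply: measurable_funB; exact: measurable_Lp_fun.
Qed.

HB.instance Definition _ := @isMetric.Build R (Lp p1)
  Lp_dist Lp_distxx Lp_dist_positivity Lp_dist_sym Lp_dist_triangle.

End LpMetric.

Section Separation.
Context {R : realType} {M : metricType R}.
Implicit Types (x y : M) (A : set M) (Q : set (set M)).

Definition diam A : \bar R :=
  ereal_sup [set (mdist x y)%:E | x in A & y in A].

(* Unlike [partition], this allows [set0] as a cluster. *)
Definition is_partition Q := cover Q id = [set: M] /\ trivIset Q id.

Definition cluster_of Q x : set M := pblock Q id x.

Section RandomPartition.
Context {d : measure_display} {Omega : measurableType d}.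
Variable P : probability Omega R.
Variable Gamma : nat -> Omega -> set M.

Definition strongly_measurable :=
  forall (i : nat) (E : set M), closed E ->
    measurable [set w | E `&` Gamma i w !=set0].

Definition partition_at (w : Omega) : set (set M) :=
  [set Gamma i w | i in [set: nat]].

Definition random_partition :=
  strongly_measurable /\ forall w, is_partition (partition_at w).

Definition bounded_partition (Delta : R) :=
  forall w x, (diam (cluster_of (partition_at w) x) <= Delta%:E)%E.

Definition separating_partition (Delta sigma : R) :=
  forall x y,
    (P [set w | cluster_of (partition_at w) x <> cluster_of (partition_at w) y] <=
     (sigma / Delta * mdist x y)%:E)%E.

End RandomPartition.
End Separation.

Definition SEP {R : realType} (M : metricType R) : \bar R :=
  ereal_inf [set sigma%:E | sigma in [set s : R | 0 <= s /\
    forall Delta : R, 0 < Delta ->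
      exists (d : measure_display) (Omega : measurableType d)
             (P : probability Omega R) (Gamma : nat -> Omega -> set M),
        [/\ random_partition Gamma,
            bounded_partition Gamma Delta &
            separating_partition P Gamma Delta s]]].

Definition SEPn {R : realType} (n : nat) (M : metricType R) : \bar R :=
  ereal_sup [set SEP (set_type C) | C in [set C : set M | (C #<= `I_n)%card]].

Lemma ge1_of_gt2 {R : realType} (p : R) : 2 < p -> (1 <= p%:E)%E.
Proof. by move=> p2; rewrite lee_fin (le_trans _ (ltW p2))// ler1n. Qed.

(* Main.v *)
Require Import Defs.
From HB Require Import structures.
From mathcomp Require Import all_boot all_order all_algebra.
From mathcomp Require Import all_classical all_reals all_analysis.
From mathcomp Require Import measurable_realfun.
From mathcomp Require Import ring lra.
Import Order.TTheory GRing.Theory Num.Theory.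
Import numFieldNormedType.Exports.

(** Lower bound.  Rademacher sums place the cube [{0, 1} ^ d] in [L_p] so that
    the two ends of every edge are at distance [1], while points at Hamming
    distance [m] are at distance at least [sqrt m], because the [L_2] norm is
    below the [L_p] norm ([cube_in_Lp]).  Clusters of diameter [sqrt d / 2] then
    have Hamming diameter at most [d / 4], and a partition of the cube into such
    clusters cuts at least half of the edges ([kept_edges]).  Hence some edge is
    cut with probability at least [1 / 2], and [SEP >= sqrt d / 4]
    ([SEP_cube_lower]).  Taking [2 ^ d <= n < 2 ^ (d + 1)] gives the constant
    [1 / 8], whatever [p] is.

    Upper bound.  Finitely many points of [L_p] can be replaced by simple
    functions, that is, by points of a finite-dimensional [l_p], at the cost of a
    factor [2] in the distances ([Lp_finite_dimensional]).  In [l_p] the clusters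
    are shrunk step by step ([lp_multiscale]).  Suppose that a cluster lies in a
    ball of radius [r], rescaled to the unit ball.  The Mazur map, which sends
    [s] to [sign s * |s| ^ (p / 2)] coordinatewise, takes that ball to the unit
    ball of [l_2] and is [p]-Lipschitz there ([mazur_sum_lipschitz]).  Its image
    is partitioned into pieces of small constant diameter, and each piece turns
    out to come from a set contained in a ball of radius [(3 / 4) ^ (1 / p) * r]:
    it is enough to move the centre towards one of the points by a fraction
    [1 / p] ([mazur_recenter], [in_balls_refine]).  One step separates [x] and
    [y] with probability [O (p sqrt (ln n) |x - y| / r)].  The radii form a
    geometric sequence of ratio [1 - Omega (1 / p)], so the last radius dominates
    up to a factor [O (p)], and the total is
    [O (p ^ 2 sqrt (ln n) |x - y| / Delta)].  No preliminary partition is needed,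
    since a single ball contains the whole finite set.

    The Hilbertian step is [euclidean_separation].  A point with small
    coordinates [v i] is turned into the law of independent coins of biases
    [v i]; the Hellinger affinity of two such laws is [exp (- Theta (t ^ 2))]
    where [t] is the distance of the points, with no dependence on the dimension
    ([affinity_bounds]).  Random labels are then drawn so that two points receive
    the same label with probability governed by the common mass of their laws
    ([consistent_sampling]).  Scaled by [sqrt (ln n)], close points are separated
    with probability [O (sqrt (ln n) |x - y|)], while far points share a label
    with probability at most [2 / n ^ 4], so that conditioning on the event that
    all far pairs are separated at most doubles the probabilities. *)

Set Implicit Arguments.
Unset Strict Implicit.
Unset Printing Implicit Defensive.

Local Open Scope ring_scope.

(** * Finitely supported probability distributions *)

(** A finitely supported (signed) distribution on [A] is a list of weighted
    outcomes; the same outcome may be listed several times. *)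
Definition fdist (R : realType) (A : eqType) := seq (R * A).

(** The expectation of [F] under [D]. *)
Definition expect (R : realType) (A : eqType) (D : fdist R A) (F : A -> R) : R :=
  \sum_(d <- D) d.1 * F d.2.

(** The probability of the event [P] under [D]. *)
Definition prob (R : realType) (A : eqType) (D : fdist R A) (P : pred A) : R :=
  expect D (fun a => (P a)%:R).

(** The weights are nonnegative and sum to [1]. *)
Definition is_dist (R : realType) (A : eqType) (D : fdist R A) : Prop :=
  (forall d, d \in D -> 0 <= d.1) /\ expect D (fun=> 1) = 1.

(** Sample an outcome [a] of [D], then an outcome of [K a]; the result is the
    pair of the two outcomes, transformed by [g]. *)
Definition bind_dist (R : realType) (A B C : eqType) (D : fdist R A)
    (K : A -> fdist R B) (g : A -> B -> C) : fdist R C :=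
  flatten [seq [seq (d.1 * e.1, g d.2 e.2) | e <- K d.2] | d <- D].

Section FiniteDistributions.
Variable R : realType.

Lemma expect_ext (A : eqType) (D : fdist R A) (F G : A -> R) :
  (forall d, d \in D -> F d.2 = G d.2) -> expect D F = expect D G.
Proof.
by move=> FG; rewrite /expect big_seq [RHS]big_seq; apply: eq_bigr => d /FG ->.
Qed.

Lemma expect_cons (A : eqType) (d : R * A) (D : fdist R A) (F : A -> R) :
  expect (d :: D) F = d.1 * F d.2 + expect D F.
Proof. exact: big_cons. Qed.

Lemma expectD (A : eqType) (D : fdist R A) (F G : A -> R) :
  expect D (fun a => F a + G a) = expect D F + expect D G.
Proof. by rewrite -big_split; apply: eq_bigr => d _; rewrite mulrDr. Qed.

Lemma expectZ (A : eqType) (D : fdist R A) k (F : A -> R) :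
  expect D (fun a => k * F a) = k * expect D F.
Proof. by rewrite /expect mulr_sumr; apply: eq_bigr => d _; rewrite mulrCA. Qed.

Lemma expect_sum (A : eqType) (D : fdist R A) (I : finType) (F : I -> A -> R) :
  expect D (fun a => \sum_i F i a) = \sum_i expect D (F i).
Proof.
rewrite /expect exchange_big; apply: eq_bigr => d _ /=; exact: mulr_sumr.
Qed.

Lemma le_expect (A : eqType) (D : fdist R A) (F G : A -> R) :
  (forall d, d \in D -> 0 <= d.1) ->
  (forall d, d \in D -> F d.2 <= G d.2) -> expect D F <= expect D G.
Proof.
move=> D0 FG; rewrite /expect big_seq [leRHS]big_seq; apply: ler_sum => d dD.
by rewrite ler_wpM2l ?D0 ?FG.
Qed.

Lemma expect_ge0 (A : eqType) (D : fdist R A) (F : A -> R) :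
  (forall d, d \in D -> 0 <= d.1) -> (forall d, d \in D -> 0 <= F d.2) ->
  0 <= expect D F.
Proof.
move=> D0 F0; rewrite /expect big_seq; apply: sumr_ge0 => d dD.
by rewrite mulr_ge0 ?D0 ?F0.
Qed.

Lemma expect_cst (A : eqType) (D : fdist R A) k :
  is_dist D -> expect D (fun=> k) = k.
Proof.
move=> -[_ D1]; rewrite -[RHS]mulr1 -D1 -expectZ.
by apply: expect_ext => d _; rewrite mulr1.
Qed.

Lemma prob_ge0 (A : eqType) (D : fdist R A) P : is_dist D -> 0 <= prob D P.
Proof. by move=> -[D0 _]; apply: expect_ge0 => // d _; exact: ler0n. Qed.

Lemma expect_bind (A B C : eqType) (D : fdist R A) (K : A -> fdist R B)
    (g : A -> B -> C) F :
  expect (bind_dist D K g) F = expect D (fun a => expect (K a) (fun b => F (g a b))).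
Proof.
rewrite /expect /bind_dist big_flatten big_map; apply: eq_bigr => d _.
by rewrite big_map mulr_sumr; apply: eq_bigr => e _ /=; rewrite mulrA.
Qed.

Lemma mem_bind (A B C : eqType) (D : fdist R A) (K : A -> fdist R B)
    (g : A -> B -> C) c : c \in bind_dist D K g ->
  exists d e, [/\ d \in D, e \in K d.2 & c = (d.1 * e.1, g d.2 e.2)].
Proof.
move=> /flatten_mapP[d dD /mapP[e eK ->]]; by exists d, e.
Qed.

Lemma is_dist_bind (A B C : eqType) (D : fdist R A) (K : A -> fdist R B)
    (g : A -> B -> C) : is_dist D -> (forall d, d \in D -> is_dist (K d.2)) ->
  is_dist (bind_dist D K g).
Proof.
move=> [D0 D1] KD; split.
  move=> c /mem_bind[d [e [dD eK ->]]] /=.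
  by rewrite mulr_ge0 ?D0//; have [+ _] := KD _ dD; apply.
rewrite expect_bind -[RHS]D1; apply: expect_ext => d dD.
by have [_ ->] := KD _ dD.
Qed.

(** Conditioning on an event of probability at least [1/2] at most doubles
    probabilities. *)
Lemma condition_dist (A : eqType) (D : fdist R A) (P : pred A) :
  is_dist D -> prob D (predC P) <= 1 / 2 ->
  exists D' : fdist R A, [/\ is_dist D',
    (forall d, d \in D' -> P d.2) &
    forall Q, prob D' Q <= 2 * prob D Q].
Proof.
move=> DD PC.
have PP : 1 / 2 <= prob D P.
  have : prob D P + prob D (predC P) = 1.
    rewrite -expectD -[RHS](expect_cst 1 DD); apply: expect_ext => d _ /=.
    by case: (P _); rewrite ?addr0 ?add0r.
  lra.
have P0 : 0 < prob D P by lra.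
pose D' : fdist R A := [seq (d.1 / prob D P, d.2) | d <- D & P d.2].
have ED' F : expect D' F = (prob D P)^-1 * expect D (fun a => (P a)%:R * F a).
  rewrite /expect big_map big_filter mulr_sumr big_mkcond.
  apply: eq_bigr => d _ /=; case: (P _) => /=; first by rewrite mul1r; ring.
  by rewrite mul0r !mulr0.
have [D0 _] := DD.
exists D'; split.
- split.
    move=> _ /mapP[d + ->] /=; rewrite mem_filter => /andP[_ dD].
    by rewrite divr_ge0 ?D0 ?ltW.
  rewrite ED' (_ : expect D _ = prob D P) ?mulVf ?gt_eqF//.
  by apply: expect_ext => d _; rewrite mulr1.
- by move=> _ /mapP[d + ->] /=; rewrite mem_filter => /andP[].
- move=> Q; rewrite /prob ED'; apply: ler_pM.
  + by rewrite invr_ge0 ltW.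
  + by apply: expect_ge0 => // d _; rewrite mulr_ge0.
  + by rewrite invf_ple ?posrE//; lra.
  + by apply: le_expect => // d _; case: (P _); rewrite ?mul1r ?mul0r.
Qed.

Lemma prob_union_bound (A : eqType) (D : fdist R A) (I : finType)
    (S : pred I) (P : I -> pred A) : is_dist D ->
  prob D (fun a => [exists i, S i && P i a]) <= \sum_(i | S i) prob D (P i).
Proof.
move=> [D0 _]; rewrite /prob.
apply: (@le_trans _ _ (expect D (fun a => \sum_i (S i && P i a)%:R))).
  apply: le_expect => // d _; case: existsP => [[i Pi]|_]; last first.
    by apply: sumr_ge0 => i _; exact: ler0n.
  rewrite (bigD1 i)//= Pi lerDl; apply: sumr_ge0 => j _; exact: ler0n.
rewrite expect_sum [leRHS]big_mkcond/=; apply: ler_sum => i _; case: (S i) => //=.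
by rewrite /expect big1// => d _; rewrite mulr0.
Qed.

End FiniteDistributions.

(** * Sampling labels consistently *)

Section ConsistentSampling.
Variable R : realType.

Lemma small_expr (a eps : R) : 0 < a -> a <= 1 -> 0 < eps ->
  exists k, (1 - a) ^+ k <= eps.
Proof.
move=> a0 a1 eps0.
have /archi_boundP : 0 <= (a * eps)^-1.
  by rewrite invr_ge0 mulr_ge0// ltW.
set k := Num.bound _ => ka; exists k.
have bernoulli i : (1 - a) ^+ i * (1 + i%:R * a) <= 1.
  elim: i => [|i IH]; first by rewrite mul0r addr0 mulr1.
  apply: le_trans IH; rewrite exprSr -mulrA ler_wpM2l ?exprn_ge0 ?subr_ge0//.
  rewrite -natr1; have : 0 <= i%:R :> R := ler0n _ _.
  nra.
have ka1 : 1 < k%:R * a * eps.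
  by move: ka; rewrite -div1r ltr_pdivrMr ?mulr_gt0// mulrA.
have := bernoulli k; set z := _ ^+ k => zk.
have z0 : 0 <= z by rewrite exprn_ge0// subr_ge0.
have ka0 : 0 < 1 + k%:R * a.
  by rewrite ltr_wpDr// mulr_ge0// ltW.
rewrite -(ler_pM2r ka0); apply: le_trans zk _.
by rewrite mulrDr mulr1 mulrC; nra.
Qed.

(** [D] is the list of superlevel sets of [w], weighted by the lengths of the
    intervals of levels that produce them. *)
Lemma layer_cake (T : finType) (w : T -> R) : (forall x, 0 <= w x) ->
  exists D : fdist R {set T}, [/\ (forall d, d \in D -> 0 <= d.1),
    (forall x y, expect D (fun A => ((x \in A) && (y \in A))%:R) =
                 Num.min (w x) (w y)) &
    forall b, 0 <= b -> (forall x, w x <= b) -> expect D (fun=> 1) <= b].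
Proof.
have [k] := ubnP #|[set x | 0 < w x]|.
elim: k => // k IH in w *; rewrite ltnS => wk w0.
have [x0 x0w|nw] := pickP (fun x => 0 < w x); last first.
  have wE x : w x = 0 by apply/eqP; rewrite eq_le w0 leNgt nw.
  exists [::]; split => //.
    by move=> x y; rewrite !wE minxx /expect big_nil.
  by move=> b b0 _; rewrite /expect big_nil.
have [x1 x1w minw] := @Order.TotalTheory.arg_minP _ _ _ x0 (fun x => 0 < w x) w x0w.
pose S := [set x | 0 < w x].
pose w' x := w x - w x1 * (x \in S)%:R.
have wS x : x \notin S -> w x = 0.
  by rewrite inE -leNgt => wx; apply/eqP; rewrite eq_le wx w0.
have w'0 x : 0 <= w' x.
  rewrite /w'; have [xS|xS] := boolP (x \in S); last by rewrite mulr0 subr0.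
  by rewrite mulr1 subr_ge0; apply: minw; move: xS; rewrite inE.
have {}wk : (#|[set x | (0 < w' x)%R]| < k)%N.
  apply: leq_trans wk; apply: proper_card; apply/properP; split.
    apply/fintype.subsetP => x; rewrite !inE => /lt_le_trans; apply.
    by rewrite /w' gerBl mulr_ge0 ?w0.
  by exists x1; rewrite !inE//= /w' inE x1w mulr1 subrr ltxx.
have [D [D0 DE Db]] := IH _ wk w'0.
exists ((w x1, S) :: D); split.
- by move=> d; rewrite inE => /orP[/eqP->|/D0//]; exact: w0.
- move=> x y; rewrite expect_cons DE /w' /=.
  have [xS|/wS ->] := boolP (x \in S); have [yS|/wS ->] := boolP (y \in S);
    rewrite ?mulr1 ?mulr0 ?subr0 ?add0r /= ?mulr1 ?mulr0 ?subr0 ?add0r; last by [].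
  + by rewrite addr_minr !subrKC.
  + by rewrite !min_r// ?w0// subr_ge0 minw//; move: xS; rewrite inE.
  + by rewrite !min_l// ?w0// subr_ge0 minw//; move: yS; rewrite inE.
- move=> b b0 wb; rewrite expect_cons /= mulr1.
  rewrite -lerBrDl; apply: Db; first by rewrite subr_ge0.
  move=> x; rewrite /w'; have [xS|/wS ->] := boolP (x \in S).
    by rewrite mulr1 lerD2r.
  by rewrite mulr0 subr0 subr_ge0.
Qed.

Lemma layer_cake_dist (T : finType) (w : T -> R) : (forall x, 0 <= w x <= 1) ->
  exists D : fdist R {set T}, is_dist D /\
    forall x y, prob D (fun A => (x \in A) && (y \in A)) = Num.min (w x) (w y).
Proof.
move=> w01; have w0 x : 0 <= w x by have /andP[] := w01 x.
have w1 x : w x <= 1 by have /andP[] := w01 x.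
have [D [D0 DE Db]] := layer_cake w0.
exists ((1 - expect D (fun=> 1), finset.set0) :: D); split.
  split => [d|]; last by rewrite expect_cons /= mulr1 subrK.
  rewrite inE => /orP[/eqP->/=|/D0//].
  by rewrite subr_ge0; apply: Db.
by move=> x y; rewrite /prob expect_cons /= inE mulr0 add0r DE.
Qed.

(** The superlevel sets of the densities at a uniformly random [j]. *)
Lemma random_set_of_densities (T J : finType) (w : T -> J -> R) : (0 < #|J|)%N ->
  (forall x j, 0 <= w x j) -> (forall x, \sum_j w x j = 1) ->
  exists D : fdist R {set T}, is_dist D /\
    forall x y, prob D (fun A => (x \in A) && (y \in A)) =
      #|J|%:R^-1 * \sum_j Num.min (w x j) (w y j).
Proof.
move=> J0 w0 w1.
have w01 j x : 0 <= w x j <= 1.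
  by rewrite w0 -(w1 x) (bigD1 j)//= lerDl sumr_ge0.
have /choice[K KP] : forall j, exists D : fdist R {set T}, is_dist D /\
    forall x y, prob D (fun A => (x \in A) && (y \in A)) = Num.min (w x j) (w y j).
  by move=> j; apply: layer_cake_dist (w01 j).
have JR : 0 < #|J|%:R :> R by rewrite ltr0n.
pose D0 : fdist R J := [seq (#|J|%:R^-1, j) | j <- enum J].
have ED0 F : expect D0 F = #|J|%:R^-1 * \sum_j F j.
  by rewrite /expect big_map big_enum /= mulr_sumr.
have D0D : is_dist D0.
  split=> [_ /mapP[j _ ->]|]; first by rewrite invr_ge0 ler0n.
  by rewrite ED0 sumr_const mulVf ?gt_eqF.
exists (bind_dist D0 K (fun _ A => A)); split.
  by apply: is_dist_bind => // d _; have [] := KP d.2.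
move=> x y; rewrite /prob expect_bind ED0; congr (_ * _).
by apply: eq_bigr => j _; have [_ <-] := KP j.
Qed.

(** Each point has a probability density on [J].  Random sets are drawn
    repeatedly, and every point is labelled by the time at which it is last
    covered, or by [0] if it never is.  Two points get different labels with
    probability at most the [L_1] distance of their densities, and the same label
    with probability at most the mass that the densities share, up to the
    probability [eps] of never being covered. *)
Lemma consistent_sampling (T J : finType) (w : T -> J -> R) (eps : R) : 0 < eps ->
  (forall x j, 0 <= w x j) -> (forall x, \sum_j w x j = 1) ->
  exists D : fdist R {ffun T -> nat}, is_dist D /\ forall x y,
    prob D (fun L => L x != L y) <= 2 * (1 - \sum_j Num.min (w x j) (w y j)) /\
    prob D (fun L => L x == L y) <= \sum_j Num.min (w x j) (w y j) + eps.
Proof.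
move=> eps0 w0 w1; have [/eqP J0|J0] := posnP #|J|.
  exists [:: (1, [ffun=> 0%N])]; split.
    split=> [d|]; first by rewrite inE => /eqP->.
    by rewrite expect_cons /expect big_nil /= mulr1 addr0.
  move=> x; have := w1 x; rewrite big_pred0 ?(eqTleqif _).
    by move/eqP; rewrite eq_sym oner_eq0.
  by move=> j; have := fintype0 j (eqP J0).
have [D1 [D1D D1E]] := random_set_of_densities J0 w0 w1.
pose a : R := #|J|%:R^-1.
have a0 : 0 < a by rewrite invr_gt0 ltr0n.
have a1 : a <= 1 by rewrite invf_le1 ?ltr0n// ler1n.
pose S x y := \sum_j Num.min (w x j) (w y j).
have Sxx x : S x x = 1 by rewrite -(w1 x); apply: eq_bigr => j _; rewrite minxx.
have S1 x y : S x y <= 1.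
  by rewrite -(w1 x); apply: ler_sum => j _; rewrite ge_min lexx.
have S0 x y : 0 <= S x y by apply: sumr_ge0 => j _; rewrite le_min !w0.
suff DP k : exists D : fdist R {ffun T -> nat}, [/\ is_dist D,
    (forall d, d \in D -> forall x, (d.2 x <= k)%N) & forall x y,
    prob D (fun L => L x != L y) <= 2 * (1 - S x y) /\
    prob D (fun L => L x == L y) <= S x y + (1 - a) ^+ k].
  have [k ke] := small_expr a0 a1 eps0.
  have [D [DD _ DE]] := DP k; exists D; split => // x y.
  have [? E2] := DE x y; split => //; apply: le_trans E2 _.
  by rewrite lerD2l.
elim: k => [|k [D [DD Dk DE]]].
  exists [:: (1, [ffun=> 0%N])]; split.
  - split=> [d|]; first by rewrite inE => /eqP->.
    by rewrite expect_cons /expect big_nil /= mulr1 addr0.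
  - by move=> d; rewrite inE => /eqP-> x /=; rewrite ffunE.
  - move=> x y; rewrite /prob !expect_cons /expect !big_nil /= !ffunE eqxx /=.
    by split; [rewrite mulr0 addr0 mulr_ge0// subr_ge0|rewrite expr0 addr0 mulr1 lerDr].
pose g (A : {set T}) (L : {ffun T -> nat}) :=
  [ffun x => if x \in A then k.+1 else L x].
pose ind (A : {set T}) x y : R := ((x \in A) && (y \in A))%:R.
have indE x y : expect D1 (fun A => ind A x y) = a * S x y by rewrite -D1E.
have split3 (x y : T) (p q r s : R) :
    expect D1 (fun A => p + q * (ind A x x) + r * ind A y y + s * ind A x y) =
    p + q * a + r * a + s * (a * S x y).
  by rewrite !expectD !expectZ expect_cst// !indE !Sxx !mulr1.
exists (bind_dist D1 (fun=> D) g); split.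
- exact: is_dist_bind.
- move=> c /mem_bind[d [e [dD eD ->]]] x /=; rewrite ffunE.
  by case: ifP => // _; rewrite ltnW// ltnS Dk.
- move=> x y; have [E1 E2] := DE x y.
  rewrite /prob !expect_bind.
  set s := prob D (fun L => L x != L y) in E1.
  set e := prob D (fun L => L x == L y) in E2.
  have s0 : 0 <= s by exact: prob_ge0.
  have e0 : 0 <= e by exact: prob_ge0.
  have -> : expect D1 (fun A => expect D (fun L => (g A L x != g A L y)%:R)) =
      expect D1 (fun A => s + (1 - s) * ind A x x + (1 - s) * ind A y y +
                          (s - 2) * ind A x y).
    apply: expect_ext => d _; set A := d.2; rewrite /ind !andbb.
    have [xA|xA] := boolP (x \in A); have [yA|yA] := boolP (y \in A) => /=.
    + rewrite (_ : expect D _ = 0) /=; last first.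
        by rewrite -[RHS](expect_cst 0 DD); apply: expect_ext => c _;
           rewrite !ffunE xA yA eqxx.
      ring.
    + rewrite (_ : expect D _ = 1) /=; last first.
        rewrite -[RHS](expect_cst 1 DD); apply: expect_ext => c cD.
        by rewrite !ffunE xA (negbTE yA) gtn_eqF// ltnS Dk.
      ring.
    + rewrite (_ : expect D _ = 1) /=; last first.
        rewrite -[RHS](expect_cst 1 DD); apply: expect_ext => c cD.
        by rewrite !ffunE yA (negbTE xA) ltn_eqF// ltnS Dk.
      ring.
    + rewrite (_ : expect D _ = s) /=; first ring.
      by apply: expect_ext => c _; rewrite !ffunE (negbTE xA) (negbTE yA).
  have -> : expect D1 (fun A => expect D (fun L => (g A L x == g A L y)%:R)) =
      expect D1 (fun A => e + (- e) * ind A x x + (- e) * ind A y y +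
                          (1 + e) * ind A x y).
    apply: expect_ext => d _; set A := d.2; rewrite /ind !andbb.
    have [xA|xA] := boolP (x \in A); have [yA|yA] := boolP (y \in A) => /=.
    + rewrite (_ : expect D _ = 1) /=; last first.
        by rewrite -[RHS](expect_cst 1 DD); apply: expect_ext => c _;
           rewrite !ffunE xA yA eqxx.
      ring.
    + rewrite (_ : expect D _ = 0) /=; last first.
        rewrite -[RHS](expect_cst 0 DD); apply: expect_ext => c cD.
        by rewrite !ffunE xA (negbTE yA) gtn_eqF// ltnS Dk.
      ring.
    + rewrite (_ : expect D _ = 0) /=; last first.
        rewrite -[RHS](expect_cst 0 DD); apply: expect_ext => c cD.
        by rewrite !ffunE yA (negbTE xA) ltn_eqF// ltnS Dk.
      ring.
    + rewrite (_ : expect D _ = e) /=; first ring.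
      by apply: expect_ext => c _; rewrite !ffunE (negbTE xA) (negbTE yA).
  (* the probability that the random set misses both points *)
  have neither : 0 <= 1 - 2 * a + a * S x y.
    have -> : 1 - 2 * a + a * S x y =
        expect D1 (fun A => 1 + (-1) * ind A x x + (-1) * ind A y y + 1 * ind A x y).
      by rewrite split3//; ring.
    apply: expect_ge0 => [d|d _]; first by have [+ _] := D1D; apply.
    by rewrite /ind !andbb; case: (x \in _); case: (y \in _) => /=; lra.
  rewrite !split3//.
  have := S0 x y; have := S1 x y; move: (S x y) neither E1 E2 => t n E1 E2 t1 t0.
  have z0 : 0 <= (1 - a) ^+ k by rewrite exprn_ge0// subr_ge0.
  rewrite exprS; move: ((1 - a) ^+ k) z0 E2 => z z0 E2.
  split.
    have : s * (1 - 2 * a + a * t) <= 2 * (1 - t) * (1 - 2 * a + a * t).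
      by rewrite ler_wpM2r.
    have : 0 <= a * (1 - t) ^+ 2 by rewrite mulr_ge0 ?sqr_ge0 ?ltW.
    lra.
  have : e * (1 - 2 * a + a * t) <= (t + z) * (1 - 2 * a + a * t).
    by rewrite ler_wpM2r.
  have : (t + z) * (1 - 2 * a + a * t) <= (t + z) * (1 - a).
    by rewrite ler_wpM2l ?addr_ge0//; nra.
  lra.
Qed.

End ConsistentSampling.

(** * Separation in Euclidean space *)

Section Euclidean.
Variable R : realType.

(** The law of a coin of bias [a]. *)
Definition coin (a : R) (b : bool) : R := if b then (1 + a) / 2 else (1 - a) / 2.

(** The law of independent coins of biases [v i]. *)
Definition coins (I : finType) (v : I -> R) (e : {ffun I -> bool}) : R :=
  \prod_i coin (v i) (e i).

Lemma sum_ffun_prod (I : finType) (F : I -> bool -> R) :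
  \sum_(e : {ffun I -> bool}) \prod_i F i (e i) = \prod_i (F i true + F i false).
Proof.
rewrite -(bigA_distr_bigA F); apply: eq_bigr => i _.
by rewrite big_bool.
Qed.

Lemma sqrt_mul_bounds (p q : R) : 1 / 4 <= p <= 3 / 4 -> 1 / 4 <= q <= 3 / 4 ->
  (p + q) / 2 - (p - q) ^+ 2 / 2 <= Num.sqrt (p * q) <=
  (p + q) / 2 - (p - q) ^+ 2 / 6.
Proof.
move=> /andP[p1 p2] /andP[q1 q2].
have p0 : 0 <= p by lra.
have q0 : 0 <= q by lra.
rewrite sqrtrM//.
have half (r : R) : 1 / 4 <= r -> 1 / 2 <= Num.sqrt r.
  have h0 : 0 <= 1 / 2 :> R by lra.
  move=> r1; rewrite -[leLHS]ger0_norm// -sqrtr_sqr; apply: ler_wsqrtr.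
  by rewrite expr2; lra.
have := half _ p1; have := half _ q1.
have := sqr_sqrtr p0; have := sqr_sqrtr q0.
move: (Num.sqrt p) (Num.sqrt q) => s t tq sp t1 s1.
rewrite -{}tq -{}sp in p1 p2 q1 q2 *.
have E : (s ^+ 2 - t ^+ 2) ^+ 2 = (s - t) ^+ 2 * (s + t) ^+ 2 by ring.
have st0 : 0 <= (s - t) ^+ 2 by exact: sqr_ge0.
rewrite E; apply/andP; split.
  have : (s - t) ^+ 2 * 1 <= (s - t) ^+ 2 * (s + t) ^+ 2.
    by rewrite ler_wpM2l//; nra.
  nra.
have : (s - t) ^+ 2 * (s + t) ^+ 2 <= (s - t) ^+ 2 * 3.
  by rewrite ler_wpM2l//; nra.
nra.
Qed.

Lemma coin_affinity (a b : R) : `|a| <= 1 / 2 -> `|b| <= 1 / 2 ->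
  1 - (a - b) ^+ 2 / 4 <=
  Num.sqrt (coin a true * coin b true) + Num.sqrt (coin a false * coin b false) <=
  1 - (a - b) ^+ 2 / 12.
Proof.
rewrite !ler_norml => /andP[a1 a2] /andP[b1 b2].
have /andP[t1 t2] : (coin a true + coin b true) / 2 - (coin a true - coin b true) ^+ 2 / 2
    <= Num.sqrt (coin a true * coin b true) <=
    (coin a true + coin b true) / 2 - (coin a true - coin b true) ^+ 2 / 6.
  by apply: sqrt_mul_bounds; rewrite /=; lra.
have /andP[f1 f2] : (coin a false + coin b false) / 2 - (coin a false - coin b false) ^+ 2 / 2
    <= Num.sqrt (coin a false * coin b false) <=
    (coin a false + coin b false) / 2 - (coin a false - coin b false) ^+ 2 / 6.
  by apply: sqrt_mul_bounds; rewrite /=; lra.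
move: t1 t2 f1 f2; set s := Num.sqrt _; set t := Num.sqrt _; rewrite /coin.
by move=> *; apply/andP; split; nra.
Qed.

Lemma prod_subr_ge (I : finType) (x : I -> R) : (forall i, 0 <= x i <= 1) ->
  1 - \sum_i x i <= \prod_i (1 - x i).
Proof.
move=> x01; suff [] : 0 <= \prod_i (1 - x i) <= 1 /\
  1 - \sum_i x i <= \prod_i (1 - x i) by [].
elim/big_ind2: _ => [|a b c d [/andP[b0 b1] ab] [/andP[d0 d1] cd]|i _].
- by rewrite lexx ler01 subr0.
- split; first by rewrite mulr_ge0//= mulr_ile1.
  suff : 0 <= (1 - b) * (1 - d) by lra.
  by rewrite mulr_ge0// subr_ge0.
- by split => //; have := x01 i; lra.
Qed.

Variable I : finType.
Implicit Types v : I -> R.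

Lemma coins_ge0 v e : (forall i, `|v i| <= 1 / 2) -> 0 <= coins v e.
Proof.
move=> v1; apply: prodr_ge0 => i _; have := v1 i; rewrite ler_norml /coin.
by case: (e i); lra.
Qed.

Lemma sum_coins v : \sum_e coins v e = 1.
Proof.
rewrite (sum_ffun_prod (fun i => coin (v i))) big1// => i _; rewrite /coin; lra.
Qed.

(** The Hellinger affinity of the laws of two families of coins. *)
Definition affinity v1 v2 := \sum_e Num.sqrt (coins v1 e * coins v2 e).

Lemma affinity_bounds v1 v2 :
  (forall i, `|v1 i| <= 1 / 2) -> (forall i, `|v2 i| <= 1 / 2) ->
  1 - (\sum_i (v1 i - v2 i) ^+ 2) / 4 <= affinity v1 v2 <=
  expR (- ((\sum_i (v1 i - v2 i) ^+ 2) / 12)).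
Proof.
move=> v1h v2h.
have c0 (a : R) b : `|a| <= 1 / 2 -> 0 <= coin a b.
  by rewrite ler_norml /coin; case: b; lra.
have -> : affinity v1 v2 = \prod_i (Num.sqrt (coin (v1 i) true * coin (v2 i) true) +
                        Num.sqrt (coin (v1 i) false * coin (v2 i) false)).
  rewrite -(sum_ffun_prod (fun i b => Num.sqrt (coin (v1 i) b * coin (v2 i) b))).
  apply: eq_bigr => e _; rewrite /coins -big_split/=.
  elim/big_rec2 : _ => [|i a b _ <-]; first by rewrite sqrtr1.
  by rewrite sqrtrM// mulr_ge0// c0.
have aff i := coin_affinity (v1h i) (v2h i).
have d01 i : 0 <= (v1 i - v2 i) ^+ 2 / 4 <= 1.
  have := v1h i; have := v2h i; rewrite !ler_norml.
  move=> /andP[? ?] /andP[? ?]; rewrite divr_ge0 ?sqr_ge0//=.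
  rewrite ler_pdivrMr// mul1r; nra.
apply/andP; split.
  rewrite mulr_suml; apply: le_trans (prod_subr_ge d01) _.
  apply: ler_prod => i _; have /andP[-> _] := aff i.
  by rewrite subr_ge0 andbT; have /andP[] := d01 i.
rewrite mulr_suml -sumrN expR_sum; apply: ler_prod => i _.
have /andP[_ h] := aff i.
rewrite addr_ge0 ?sqrtr_ge0//=; apply: le_trans h _.
exact: expR_ge1Dx.
Qed.

Lemma shared_coins_le v1 v2 :
  (forall i, `|v1 i| <= 1 / 2) -> (forall i, `|v2 i| <= 1 / 2) ->
  \sum_e Num.min (coins v1 e) (coins v2 e) <=
  expR (- ((\sum_i (v1 i - v2 i) ^+ 2) / 12)).
Proof.
move=> v1h v2h; have /andP[_] := affinity_bounds v1h v2h.
apply: le_trans; apply: ler_sum => e _.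
have c1 := coins_ge0 e v1h; have c2 := coins_ge0 e v2h.
have m0 : 0 <= Num.min (coins v1 e) (coins v2 e) by rewrite le_min c1.
rewrite -[leLHS]ger0_norm// -sqrtr_sqr ler_wsqrtr// expr2 ler_pM//.
  by rewrite ge_min lexx.
by rewrite ge_min lexx orbT.
Qed.

(** The left-hand side is the [L_1] distance of the two laws. *)
Lemma coins_distance_le v1 v2 (t : R) :
  (forall i, `|v1 i| <= 1 / 2) -> (forall i, `|v2 i| <= 1 / 2) ->
  0 <= t -> \sum_i (v1 i - v2 i) ^+ 2 = t ^+ 2 ->
  2 * (1 - \sum_e Num.min (coins v1 e) (coins v2 e)) <= 3 / 2 * t.
Proof.
move=> v1h v2h; rewrite le_eqVlt => /orP[/eqP<-|t0] E.
  have v12 i : v1 i = v2 i.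
    apply/eqP; rewrite -subr_eq0 -sqrf_eq0; apply/eqP.
    have sq0 (j : I) : xpredT j -> 0 <= (v1 j - v2 j) ^+ 2 by rewrite sqr_ge0.
    have E0 : \sum_(j | xpredT j) (v1 j - v2 j) ^+ 2 = 0 by rewrite E expr0n.
    exact: (psumr_eq0P sq0 E0 isT).
  rewrite mulr0 (_ : \sum_e _ = 1) ?subrr ?mulr0// -(sum_coins v1).
  apply: eq_bigr => e _; rewrite (_ : coins v2 e = coins v1 e) ?minxx//.
  by apply: eq_bigr => i _; rewrite v12.
have /andP[] := affinity_bounds v1h v2h; rewrite E => affl _.
(* AM-GM at scale [t / 2] in
   [|a - b| = |sqrt a - sqrt b| * (sqrt a + sqrt b)] *)
have key e : coins v1 e + coins v2 e - 2 * Num.min (coins v1 e) (coins v2 e) <=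
    (coins v1 e + coins v2 e - 2 * Num.sqrt (coins v1 e * coins v2 e)) / t +
    t / 4 * (coins v1 e + coins v2 e + 2 * Num.sqrt (coins v1 e * coins v2 e)).
  have c1 := coins_ge0 e v1h; have c2 := coins_ge0 e v2h.
  rewrite sqrtrM//; have := sqr_sqrtr c1; have := sqr_sqrtr c2.
  have := sqrtr_ge0 (coins v1 e); have := sqrtr_ge0 (coins v2 e).
  move: (Num.sqrt (coins v1 e)) (Num.sqrt (coins v2 e)) => b a a0 b0 <- <-.
  have -> : (b ^+ 2 + a ^+ 2 - 2 * (b * a)) / t + t / 4 * (b ^+ 2 + a ^+ 2 + 2 * (b * a))
     = (b - a) ^+ 2 / t + t / 4 * (a + b) ^+ 2 by ring.
  have amgm : `|b - a| * (a + b) <= (b - a) ^+ 2 / t + t / 4 * (a + b) ^+ 2.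
    rewrite -(@ler_pM2r _ t)// mulrDl divfK ?gt_eqF//.
    rewrite -real_normK ?num_real//; have := sqr_ge0 (`|b - a| - t / 2 * (a + b)).
    nra.
  apply: le_trans amgm.
  have [ab|ba] := lerP a b.
    rewrite min_r ?ger0_norm ?subr_ge0//; last by rewrite ler_sqr.
    by nra.
  rewrite min_l ?ltr0_norm ?subr_lt0//; last by rewrite ler_sqr// ltW.
  by nra.
have : 2 - 2 * \sum_e Num.min (coins v1 e) (coins v2 e) <=
    (2 - 2 * affinity v1 v2) / t + t / 4 * (2 + 2 * affinity v1 v2).
  have := @ler_sum _ _ (index_enum _) predT _ _ (fun e _ => key e).
  rewrite !(big_split, sumrN)/= -mulr_suml -!mulr_sumr !(big_split, sumrN)/=.
  by rewrite -!mulr_sumr !sum_coins -/(affinity _ _); lra.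
have aff1 : affinity v1 v2 <= 1.
  suff : affinity v1 v2 <= \sum_e (coins v1 e / 2 + coins v2 e / 2).
    by rewrite big_split/= -!mulr_suml !sum_coins; lra.
  apply: ler_sum => e _; have c1 := coins_ge0 e v1h; have c2 := coins_ge0 e v2h.
  rewrite sqrtrM//; have := sqr_sqrtr c1; have := sqr_sqrtr c2.
  move: (Num.sqrt (coins v1 e)) (Num.sqrt (coins v2 e)) => a b <- <-; have := sqr_ge0 (a - b); nra.
have : (2 - 2 * affinity v1 v2) / t <= t / 2.
  by rewrite ler_pdivrMr//; lra.
have : t / 4 * (2 + 2 * affinity v1 v2) <= t / 4 * 4.
  by rewrite ler_wpM2l//; lra.
lra.
Qed.

End Euclidean.

(** A finite subset of a Euclidean space has random partitions into clusters of
    fixed diameter that separate points at rate [O(sqrt (ln n))].  Spreading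
    each coordinate over many copies makes the biases of the coins small. *)
Lemma euclidean_separation (R : realType) (T I : finType) (n : nat)
    (u : T -> I -> R) : (1 < n)%N -> (#|T| <= n)%N ->
  exists D : fdist R {ffun T -> nat}, [/\ is_dist D,
    (forall d, d \in D -> forall x y, d.2 x = d.2 y ->
       \sum_i (u x i - u y i) ^+ 2 <= 1 / 192) &
    forall x y, prob D (fun L => L x != L y) <=
      288 * Num.sqrt (ln n%:R) * Num.sqrt (\sum_i (u x i - u y i) ^+ 2)].
Proof.
move=> n1 Tn.
have n0 : 0 < n%:R :> R by rewrite ltr0n ltnW.
have n2 : 2 <= n%:R :> R by rewrite ler_nat.
have ln0 : 0 <= ln n%:R :> R by rewrite ln_ge0// ler1n ltnW.
pose l : R := 96 * Num.sqrt (ln n%:R).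
have l0 : 0 <= l by rewrite mulr_ge0// sqrtr_ge0.
pose B := \sum_x \sum_i `|l * u x i|.
have uB x i : `|l * u x i| <= B.
  rewrite /B (bigD1 x)//= (bigD1 i)//= -addrA lerDl.
  by rewrite addr_ge0 ?sumr_ge0// => y _; rewrite sumr_ge0.
have B0 : 0 <= B by apply: sumr_ge0 => x _; apply: sumr_ge0.
have /archi_boundP : 0 <= (2 * B) ^+ 2 by rewrite sqr_ge0.
set m := Num.bound _ => mB.
have m0 : 0 < m%:R :> R by apply: le_lt_trans mB; rewrite sqr_ge0.
have sm0 : 0 < Num.sqrt m%:R :> R by rewrite sqrtr_gt0.
pose v x (k : I * 'I_m) := l * u x k.1 / Num.sqrt m%:R.
have vh x k : `|v x k| <= 1 / 2.
  rewrite normrM normfV (ger0_norm (ltW sm0)) ler_pdivrMr//.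
  apply: le_trans (uB _ _) _; suff : 2 * B <= Num.sqrt m%:R by lra.
  rewrite -[leLHS]ger0_norm ?mulr_ge0// -sqrtr_sqr ler_wsqrtr//; exact: ltW.
have vE x y : \sum_k (v x k - v y k) ^+ 2 = l ^+ 2 * \sum_i (u x i - u y i) ^+ 2.
  rewrite -(pair_bigA _ (fun i j => (v x (i, j) - v y (i, j)) ^+ 2))/= mulr_sumr.
  apply: eq_bigr => i _; rewrite /v /= sumr_const card_ord.
  set z := (X in X *+ m); rewrite -[z *+ m]mulr_natl {}/z.
  rewrite -mulrBl exprMn exprVn sqr_sqrtr ?ler0n//.
  by field; rewrite gt_eqF.
pose eps : R := expR (- (4 * ln n%:R)).
have epsE : eps = (n%:R ^+ 4)^-1.
  by rewrite /eps -(ln_powR n%:R 4) expRN powR_mulrn ?ler0n// lnK// posrE exprn_gt0.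
have eps0 : 0 < eps by exact: expR_gt0.
have [D [DD DE]] := @consistent_sampling R T _ (fun x => coins (v x)) _ eps0
  (fun x e => coins_ge0 e (vh x)) (fun x => sum_coins (v x)).
pose far (p : T * T) := 1 / 192 < \sum_i (u p.1 i - u p.2 i) ^+ 2.
pose bad (p : T * T) (L : {ffun T -> nat}) := L p.1 == L p.2.
have badE p : far p -> prob D (bad p) <= 2 * eps.
  move=> fp; have [_ E] := DE p.1 p.2; apply: le_trans E _.
  suff : \sum_e Num.min (coins (v p.1) e) (coins (v p.2) e) <= eps by lra.
  apply: le_trans (shared_coins_le (vh p.1) (vh p.2)) _.
  rewrite ler_expR lerN2 vE exprMn sqr_sqrtr//.
  by move: fp; rewrite /far; nra.
have [D' [D'D D'P D'E]] : exists D' : fdist R {ffun T -> nat}, [/\ is_dist D',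
    (forall d, d \in D' -> ~~ [exists p, far p && bad p d.2]) &
    forall Q, prob D' Q <= 2 * prob D Q].
  apply: (@condition_dist _ _ _ (fun L => ~~ [exists p, far p && bad p L])) => //.
  rewrite (_ : prob D _ = prob D (fun L => [exists p, far p && bad p L])); last first.
    by apply: expect_ext => d _ /=; rewrite negbK.
  apply: le_trans (prob_union_bound _ _ DD) _.
  apply: (@le_trans _ _ (\sum_(p : T * T) 2 * eps)).
    rewrite [leLHS]big_mkcond; apply: ler_sum => p _.
    by case: ifPn => [/badE//|_]; rewrite mulr_ge0// ltW.
  rewrite sumr_const card_prod -[leLHS]mulr_natl natrM.
  apply: (@le_trans _ _ (n%:R * n%:R * (2 * eps))).
    by rewrite ler_wpM2r ?mulr_ge0 ?(ltW eps0)// ler_pM ?ler0n// ler_nat.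
  rewrite epsE [leLHS](_ : _ = 2 / n%:R ^+ 2); last by field; rewrite gt_eqF.
  by rewrite ler_pdivrMr ?exprn_gt0//; nra.
exists D'; split => //.
- move=> d /D'P /existsPn nb x y dxy; rewrite leNgt; apply/negP => fxy.
  by have := nb (x, y); rewrite /far /bad /= fxy dxy eqxx.
- move=> x y; apply: le_trans (D'E _) _; have [E _] := DE x y.
  set t := \sum_i _; have t0 : 0 <= t by apply: sumr_ge0 => i _; rewrite sqr_ge0.
  have tE : \sum_k (v x k - v y k) ^+ 2 = (l * Num.sqrt t) ^+ 2.
    by rewrite vE [in RHS]exprMn [in RHS](sqr_sqrtr t0).
  have lt0 : 0 <= l * Num.sqrt t by rewrite mulr_ge0 ?sqrtr_ge0.
  have := coins_distance_le (vh x) (vh y) lt0 tE.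
  move: E; rewrite /l; lra.
Qed.

(** * The Mazur map *)

Section Mazur.
Variables (R : realType) (p : R).

Lemma young_square (p2 : 2 < p) (x y : R) : 0 <= x -> 0 <= y ->
  x ^+ 2 * y `^ (p - 2) <= 2 / p * x `^ p + (p - 2) / p * y `^ p.
Proof.
have p0 : 0 < p by lra.
move=> x0 y0.
have h1 : 0 < p / 2 by lra.
have h2 : 0 < p / (p - 2) by rewrite divr_gt0// subr_gt0.
have h3 : (p / 2)^-1 + (p / (p - 2))^-1 = 1.
  by field; rewrite !gt_eqF// subr_gt0.
have := conjugate_powR (sqr_ge0 x) (powR_ge0 y (p - 2)) h1 h2 h3.
rewrite -(powR_mulrn 2 x0) -!powRrM (_ : 2 * (p / 2) = p); last by field.
rewrite (_ : (p - 2) * _ = p); last by field; rewrite gt_eqF// subr_gt0.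
by rewrite !invf_div mulrC [_ / p * _]mulrC [(p - 2) / p * _]mulrC mulrC.
Qed.

(** The Mazur map, from the unit ball of [l_p] to that of [l_2]. *)
Definition mazur (s : R) : R := Num.sg s * `|s| `^ (p / 2).

Lemma mazurN s : mazur (- s) = - mazur s.
Proof. by rewrite /mazur sgrN normrN mulNr. Qed.

Lemma mazur_ge0 (p2 : 2 < p) s : 0 <= s -> mazur s = s `^ (p / 2).
Proof.
have p0 : 0 < p by lra.
rewrite le_eqVlt => /orP[/eqP<-|s0].
  by rewrite /mazur sgr0 mul0r powR0// gt_eqF//; lra.
by rewrite /mazur gtr0_sg// mul1r gtr0_norm.
Qed.

Lemma powR_half_sqr s : (s `^ (p / 2)) ^+ 2 = s `^ p.
Proof.
by rewrite -powR_mulrn ?powR_ge0// -powRrM (_ : p / 2 * 2 = p)//; field.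
Qed.

Lemma powR_slope (p2 : 2 < p) (s t : R) : 0 <= t -> t <= s ->
  s `^ (p / 2) - t `^ (p / 2) <= p / 2 * (s - t) * s `^ (p / 2 - 1).
Proof.
have p0 : 0 < p by lra.
move=> t0 ts; have s0 : 0 <= s by lra.
have h1 : 0 < p / 2 by lra.
have h2 : 0 < (p / 2) / (p / 2 - 1) by rewrite divr_gt0//; lra.
have h3 : (p / 2)^-1 + ((p / 2) / (p / 2 - 1))^-1 = 1.
  by field; rewrite !gt_eqF// subr_gt0.
have := conjugate_powR t0 (powR_ge0 s (p / 2 - 1)) h1 h2 h3.
rewrite -powRrM (_ : (p / 2 - 1) * _ = p / 2); last by field; rewrite gt_eqF// subr_gt0.
have E := mulr_powRB1 s0 h1.
move: E; set z := s `^ (p / 2 - 1) => <-.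
set w := t `^ (p / 2); rewrite !invf_div => Y.
have : p / 2 * (t * z) <= p / 2 * (w * (2 / p) + s * z * ((p / 2 - 1) * (2 / p))).
  by rewrite ler_pM2l.
have -> : p / 2 * (w * (2 / p) + s * z * ((p / 2 - 1) * (2 / p))) =
  w + s * z * (p / 2 - 1) by field; rewrite gt_eqF.
nra.
Qed.

Lemma mazur_lipschitz (p2 : 2 < p) (s t : R) :
  (mazur s - mazur t) ^+ 2 <=
  p ^+ 2 / 4 * (s - t) ^+ 2 * (`|s| `^ (p - 2) + `|t| `^ (p - 2)).
Proof.
have p0 : 0 < p by lra.
wlog ts : s t / `|t| <= `|s|.
  move=> H; have [|/ltW ts] := lerP `|t| `|s|; first exact: H.
  have -> : (mazur s - mazur t) ^+ 2 = (mazur t - mazur s) ^+ 2 by ring.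
  have -> : (s - t) ^+ 2 = (t - s) ^+ 2 by ring.
  by rewrite [X in _ <= _ * X]addrC; exact: H.
wlog s0 : s t ts / 0 <= s.
  move=> H; have [|/ltW s0] := lerP 0 s; first exact: H.
  have := H (- s) (- t); rewrite !normrN oppr_ge0 => /(_ ts s0).
  by rewrite !mazurN -!opprD !sqrrN.
rewrite (ger0_norm s0) in ts *.
have key : `|mazur s - mazur t| <= p / 2 * `|s - t| * s `^ (p / 2 - 1).
  rewrite (mazur_ge0 p2 s0); have [t0|t0] := lerP 0 t.
    rewrite (ger0_norm t0) in ts.
    rewrite (mazur_ge0 p2)// !ger0_norm ?subr_ge0//; first exact: powR_slope.
    by apply: ge0_ler_powR; rewrite ?nnegrE//; lra.
  have -> : mazur t = - ((- t) `^ (p / 2)).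
    by rewrite -(mazur_ge0 p2) ?mazurN ?opprK//; lra.
  rewrite (ltr0_norm t0) in ts.
  have mt0 : 0 <= - t by lra.
  have h1 : 0 < p / 2 by lra.
  rewrite !ger0_norm ?opprK ?addr_ge0 ?powR_ge0//.
  rewrite -(mulr_powRB1 s0 h1) -(mulr_powRB1 mt0 h1).
  have z1 : (- t) `^ (p / 2 - 1) <= s `^ (p / 2 - 1).
    by apply: ge0_ler_powR; rewrite ?nnegrE//; lra.
  have := powR_ge0 (- t) (p / 2 - 1); move: ((- t) `^ (p / 2 - 1)) (s `^ (p / 2 - 1)) z1 => z w z1 z0.
  have : - t * z <= - t * w by rewrite ler_wpM2l.
  have : 0 <= (p / 2 - 1) * (s - t) * w by rewrite !mulr_ge0//; lra.
  lra.
rewrite -[leLHS]real_normK ?num_real//.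
apply: (@le_trans _ _ ((p / 2 * `|s - t| * s `^ (p / 2 - 1)) ^+ 2)).
  by rewrite ler_sqr ?nnegrE//; apply: le_trans key.
have -> : (p / 2 * `|s - t| * s `^ (p / 2 - 1)) ^+ 2 =
    p ^+ 2 / 4 * `|s - t| ^+ 2 * (s `^ (p / 2 - 1)) ^+ 2 by field.
have -> : (s `^ (p / 2 - 1)) ^+ 2 = s `^ (p - 2).
  by rewrite -powR_mulrn ?powR_ge0// -powRrM; congr (_ `^ _); field.
rewrite real_normK ?num_real//.
by rewrite ler_wpM2l ?lerDl ?powR_ge0// mulr_ge0 ?sqr_ge0// divr_ge0 ?sqr_ge0.
Qed.

Lemma powR_sub_half_le (p2 : 2 < p) : (1 - 1 / (2 * p)) `^ p <= 2 / 3.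
Proof.
have p0 : 0 < p by lra.
have e0 : 0 < 1 / (2 * p) by rewrite divr_gt0// mulr_gt0.
have e1 : 1 / (2 * p) < 1 / 2.
  by rewrite ltr_pdivrMr ?mulr_gt0//; lra.
rewrite /powR gt_eqF ?subr_gt0//; last lra.
apply: (@le_trans _ _ (expR (- (1 / 2)))).
  rewrite ler_expR; apply: (@le_trans _ _ (p * (- (1 / (2 * p))))).
    by rewrite ler_wpM2l ?(ltW p0)//; apply: le_ln1Dx; lra.
  by rewrite le_eqVlt; apply/orP; left; apply/eqP; field; rewrite gt_eqF.
rewrite expRN invf_ple ?posrE ?expR_gt0 ?divr_gt0//.
by apply: le_trans (expR_ge1Dx _); lra.
Qed.

Lemma powR_add_inv_le (p2 : 2 < p) : (1 + 1 / p) `^ p <= 4.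
Proof.
have p0 : 0 < p by lra.
have e0 : 0 < 1 / p by rewrite divr_gt0.
rewrite /powR gt_eqF; last lra.
apply: (@le_trans _ _ (expR (1 / 2 + 1 / 2))).
  rewrite ler_expR; apply: (@le_trans _ _ (p * (1 / p))).
    by rewrite ler_wpM2l ?(ltW p0)//; apply: le_ln1Dx; lra.
  by rewrite mulrC divfK ?gt_eqF//; lra.
have h : expR (1 / 2 : R) <= 2.
  have := expR_ge1Dx (- (1 / 2) : R); rewrite expRN => h.
  have : expR (1 / 2 : R) * (1 / 2) <= expR (1 / 2) * (expR (1 / 2))^-1.
    by rewrite ler_wpM2l ?expR_ge0//; lra.
  by rewrite divff ?gt_eqF ?expR_gt0//; lra.
by rewrite expRD; have := expR_ge0 (1 / 2 : R); nra.
Qed.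

(** If the Mazur images of [s] and [t] are close, then moving the origin
    slightly towards [t] brings it closer to [s]: where [s] and [t] are
    comparable the distance drops by a factor [1 - 1 / (2 p)], and elsewhere
    the images differ by as much as their size. *)
Lemma mazur_recenter (p2 : 2 < p) (s t : R) :
  `|s - t / p| `^ p <= 2 / 3 * `|s| `^ p + 16 * (mazur s - mazur t) ^+ 2.
Proof.
have p0 : 0 < p by lra.
wlog s0 : s t / 0 <= s.
  move=> H; have [|/ltW s0] := lerP 0 s; first exact: H.
  have := H (- s) (- t); rewrite oppr_ge0 => /(_ s0).
  by rewrite !mazurN mulNr -!opprD !normrN sqrrN.
have ip0 : 0 < p^-1 by rewrite invr_gt0.
have ip1 : p^-1 < 1 / 2.
  by rewrite invf_plt ?posrE//; lra.
have [/andP[t1 t2]|bad] := boolP (s / 2 <= t <= 2 * s).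
  have h : 0 <= s - t / p <= s * (1 - 1 / (2 * p)).
    rewrite invfM; apply/andP; split; nra.
  have /andP[h1 h2] := h.
  apply: (@le_trans _ _ (2 / 3 * `|s| `^ p)); last first.
    by rewrite lerDl mulr_ge0 ?sqr_ge0.
  rewrite !ger0_norm//.
  apply: (@le_trans _ _ ((s * (1 - 1 / (2 * p))) `^ p)).
    by apply: ge0_ler_powR; rewrite ?nnegrE//; [exact: ltW|exact: le_trans h2].
  rewrite powRM//; last by rewrite invfM; lra.
  by rewrite mulrC ler_wpM2r ?powR_ge0// (powR_sub_half_le p2).
pose m := Num.max s `|t|.
have m0 : 0 <= m by rewrite le_max s0.
have sm : s <= m by rewrite le_max lexx.
have tm : `|t| <= m by rewrite le_max lexx orbT.
apply: (@le_trans _ _ (16 * (mazur s - mazur t) ^+ 2)); last first.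
  by rewrite lerDr mulr_ge0 ?powR_ge0 ?divr_ge0.
apply: (@le_trans _ _ (4 * m `^ p)).
  apply: (@le_trans _ _ (((1 + 1 / p) * m) `^ p)).
    apply: ge0_ler_powR; rewrite ?nnegrE ?(ltW p0)//.
      by rewrite mulr_ge0// addr_ge0// divr_ge0// ltW.
    apply: le_trans (ler_normB _ _) _; rewrite (ger0_norm s0) mulrDl mul1r lerD//.
    by rewrite normrM (gtr0_norm ip0) div1r mulrC ler_wpM2l// ltW.
  rewrite powRM//; last by rewrite addr_ge0// divr_ge0// ltW.
  by rewrite ler_wpM2r ?powR_ge0// (powR_add_inv_le p2).
rewrite -powR_half_sqr -[X in _ <= 16 * X]real_normK ?num_real//.
suff : m `^ (p / 2) <= 2 * `|mazur s - mazur t|.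
  move=> h; have := powR_ge0 m (p / 2); move: h; set a := _ `^ _; set b := `|_|.
  by nra.
(* halving the argument at least halves the power *)
have half (x y : R) : 0 <= x -> x <= y / 2 -> x `^ (p / 2) <= y `^ (p / 2) / 2.
  move=> x0 xy; have y0 : 0 <= y by lra.
  apply: (@le_trans _ _ ((2^-1 * y) `^ (p / 2))).
    by apply: ge0_ler_powR; rewrite ?nnegrE//; lra.
  rewrite powRM ?invr_ge0// mulrC ler_wpM2l ?powR_ge0//.
  by apply: ge1r_powR; [apply/andP; split; lra|lra].
rewrite (mazur_ge0 p2 s0); have [t0|t0] := lerP 0 t; last first.
  have -> : mazur t = - ((- t) `^ (p / 2)).
    by rewrite -(mazur_ge0 p2) ?mazurN ?opprK//; lra.
  rewrite opprK ger0_norm ?addr_ge0 ?powR_ge0// /m (ltr0_norm t0).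
  have := powR_ge0 s (p / 2); have := powR_ge0 (- t) (p / 2).
  by case: (leP s (- t)) => _; lra.
rewrite (mazur_ge0 p2)// /m (ger0_norm t0).
have [ts|st] := ltrP t (s / 2).
  rewrite max_l; last lra.
  have := half _ _ t0 (ltW ts); have := ler_norm (s `^ (p / 2) - t `^ (p / 2)); lra.
have st2 : s <= t / 2.
  by move: bad; rewrite st/= -ltNge; lra.
rewrite max_r; last lra.
have := half _ _ s0 st2; have := ler_norm (- (s `^ (p / 2) - t `^ (p / 2))).
rewrite normrN; lra.
Qed.

End Mazur.

(** * Separation in [l_p] *)

(** The [p]-th power of the norm of [x] in [l_p]. *)
Definition lp_pow (R : realType) (p : R) (I : finType) (x : I -> R) : R :=
  \sum_i `|x i| `^ p.

(** The distance of [x] and [y] in [l_p]. *)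
Definition lp_dist (R : realType) (p : R) (I : finType) (x y : I -> R) : R :=
  lp_pow p (fun i => x i - y i) `^ p^-1.

(** Every cluster of the labelling [L] is mapped by [f] into a ball of radius
    [r]; [h x] is the centre for the cluster of [x]. *)
Definition in_balls (R : realType) (p : R) (T I : finType) (f : T -> I -> R)
    (r : R) (L : {ffun T -> nat}) : Prop :=
  exists h : T -> I -> R, (forall x y, L x = L y -> h x = h y) /\
    forall x, lp_pow p (fun i => f x i - h x i) <= r `^ p.

(** The common refinement of two labellings. *)
Definition refine_label (T : finType) (L M : {ffun T -> nat}) : {ffun T -> nat} :=
  [ffun x => pickle (L x, M x)].

Lemma refine_labelP (T : finType) (L M : {ffun T -> nat}) x y :
  (refine_label L M x == refine_label L M y) = (L x == L y) && (M x == M y).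
Proof.
by rewrite !ffunE (inj_eq (pcan_inj (@pickleK (nat * nat)%type))) xpair_eqE.
Qed.

Section LpSeparation.
Variables (R : realType) (p : R).

Lemma lp_pow_ge0 (I : finType) (x : I -> R) : 0 <= lp_pow p x.
Proof. by apply: sumr_ge0 => i _; exact: powR_ge0. Qed.

Lemma lp_powZ (I : finType) k (x : I -> R) :
  lp_pow p (fun i => k * x i) = `|k| `^ p * lp_pow p x.
Proof.
by rewrite mulr_sumr; apply: eq_bigr => i _; rewrite normrM powRM.
Qed.

Lemma lp_pow_eq0 (I : finType) (x : I -> R) : lp_pow p x = 0 -> forall i, x i = 0.
Proof.
move=> x0 i; have e0 (j : I) : xpredT j -> 0 <= `|x j| `^ p by rewrite powR_ge0.
have xi0 : `|x i| `^ p = 0 by exact: (psumr_eq0P e0 x0 isT).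
by apply/normr0_eq0; exact: powR_eq0_eq0 xi0.
Qed.

Lemma lp_dist_ge0 (I : finType) (x y : I -> R) : 0 <= lp_dist p x y.
Proof. exact: powR_ge0. Qed.

Lemma mazur_sum_lipschitz (p2 : 2 < p) (I : finType) (s t : I -> R) :
  lp_pow p s <= 1 -> lp_pow p t <= 1 ->
  \sum_i (mazur p (s i) - mazur p (t i)) ^+ 2 <= (p * lp_dist p s t) ^+ 2.
Proof.
have p0 : 0 < p by lra.
move=> s1 t1; have D0 := lp_dist_ge0 s t.
have pD : lp_dist p s t `^ p = lp_pow p (fun i => s i - t i).
  by rewrite /lp_dist -powRrM mulVf ?gt_eqF// powRr1// lp_pow_ge0.
move: D0; rewrite le_eqVlt => /orP[/eqP D0|D0].
  have st i : s i = t i.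
    apply/eqP; rewrite -subr_eq0; apply/eqP.
    apply: (@lp_pow_eq0 _ (fun i => s i - t i)).
    by rewrite -pD -D0 powR0// gt_eqF.
  rewrite big1 ?sqr_ge0// => i _; by rewrite st subrr expr0n.
set D := lp_dist p s t in D0 pD *.
(* Young's inequality with exponents [p / 2] and [p / (p - 2)] *)
have young (u : I -> R) : lp_pow p u <= 1 ->
    \sum_i (s i - t i) ^+ 2 * `|u i| `^ (p - 2) <= D ^+ 2.
  move=> u1.
  have E : \sum_i (s i - t i) ^+ 2 * `|u i| `^ (p - 2) =
      D ^+ 2 * \sum_i (`|s i - t i| / D) ^+ 2 * `|u i| `^ (p - 2).
    rewrite mulr_sumr; apply: eq_bigr => i _.
    by rewrite mulrA exprMn mulrCA -exprMn divff ?gt_eqF// expr1n mulr1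
      real_normK ?num_real.
  rewrite E -[leRHS]mulr1 ler_wpM2l ?sqr_ge0//.
  apply: (@le_trans _ _ (\sum_i (2 / p * (`|s i - t i| / D) `^ p +
                                (p - 2) / p * `|u i| `^ p))).
    by apply: ler_sum => i _; apply: young_square => //; rewrite divr_ge0// ltW.
  rewrite big_split/= -!mulr_sumr -/(lp_pow p u).
  have -> : \sum_i (`|s i - t i| / D) `^ p = 1.
    under eq_bigr do rewrite powRM ?invr_ge0 ?(ltW D0)//.
    rewrite -mulr_suml -/(lp_pow p (fun i => s i - t i)) -pD -powRM ?invr_ge0 ?(ltW D0)//.
    by rewrite divff ?gt_eqF// powR1.
  have : (p - 2) / p * lp_pow p u <= (p - 2) / p * 1.
    by rewrite ler_wpM2l// divr_ge0//; lra.
  have -> : (p - 2) / p = 1 - 2 / p by field; rewrite gt_eqF.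
  lra.
apply: (@le_trans _ _ (p ^+ 2 / 4 * (\sum_i (s i - t i) ^+ 2 * `|s i| `^ (p - 2) +
    \sum_i (s i - t i) ^+ 2 * `|t i| `^ (p - 2)))).
  rewrite -big_split mulr_sumr; apply: ler_sum => i _ /=.
  by rewrite -mulrDr mulrA; exact: mazur_lipschitz.
have := young _ s1; have := young _ t1; set a := \sum_i _; set b := \sum_i _.
move=> aD bD; have : p ^+ 2 / 4 * (b + a) <= p ^+ 2 / 4 * (D ^+ 2 + D ^+ 2).
  by rewrite ler_wpM2l ?lerD// divr_ge0 ?sqr_ge0.
have : 0 <= p ^+ 2 * D ^+ 2 by rewrite mulr_ge0 ?sqr_ge0.
rewrite exprMn; lra.
Qed.

(** One step of the construction: the Mazur images of the clusters, recentred
    and rescaled, are partitioned by [euclidean_separation]. *)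
Lemma in_balls_refine (p2 : 2 < p) (T I : finType) (n : nat) (f : T -> I -> R)
    (r : R) (L : {ffun T -> nat}) : (1 < n)%N -> (#|T| <= n)%N -> 0 < r ->
  in_balls p f r L ->
  exists D : fdist R {ffun T -> nat}, [/\ is_dist D,
    (forall d, d \in D ->
       in_balls p f ((3 / 4) `^ p^-1 * r) (refine_label L d.2)) &
    forall x y, L x = L y -> prob D (fun M => M x != M y) <=
      288 * p * Num.sqrt (ln n%:R) / r * lp_dist p (f x) (f y)].
Proof.
have p0 : 0 < p by lra.
move=> n1 Tn r0 [h [hL hr]].
pose s x i := r^-1 * (f x i - h x i).
have s1 x : lp_pow p (s x) <= 1.
  rewrite lp_powZ normfV (gtr0_norm r0) -powR_inv1 ?(ltW r0)// powRAC powR_inv1 ?powR_ge0//.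
  by rewrite ler_pdivrMl ?powR_gt0// mulr1.
have [D [DD Dclose Dsep]] := euclidean_separation (fun x i => mazur p (s x i)) n1 Tn.
exists D; split => //.
- move=> d /Dclose close; set M := refine_label L d.2.
  pose rep x := odflt x [pick z | M z == M x].
  have repM x : M (rep x) = M x.
    by rewrite /rep; case: pickP => [z /eqP//|].
  have repE x y : M x = M y -> rep x = rep y.
    move=> Mxy; rewrite /rep Mxy; case: pickP => //= /(_ y); by rewrite eqxx.
  have ML x y : M x = M y -> h x = h y /\ d.2 x = d.2 y.
    by move/eqP; rewrite refine_labelP => /andP[/eqP/hL ? /eqP].
  exists (fun x i => h x i + r * (s (rep x) i / p)); split.
    by move=> x y Mxy; rewrite (repE _ _ Mxy) (ML _ _ Mxy).1.
  move=> x; have fE i : f x i - (h x i + r * (s (rep x) i / p)) =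
      r * (s x i - s (rep x) i / p).
    by rewrite /s; field; rewrite !gt_eqF.
  rewrite (_ : (fun i => _) = fun i => r * (s x i - s (rep x) i / p)); last first.
    by apply/funext.
  rewrite lp_powZ (gtr0_norm r0) powRM ?powR_ge0 ?(ltW r0)//.
  rewrite -powRrM mulVf ?gt_eqF// powRr1 ?divr_ge0// mulrC ler_wpM2r ?powR_ge0//.
  apply: (@le_trans _ _ (\sum_i (2 / 3 * `|s x i| `^ p +
      16 * (mazur p (s x i) - mazur p (s (rep x) i)) ^+ 2))).
    by apply: ler_sum => i _; exact: mazur_recenter.
  rewrite big_split/= -!mulr_sumr -/(lp_pow p (s x)).
  have := close x (rep x) (esym (ML _ _ (repM x)).2); have := s1 x; lra.
- move=> x y Lxy; apply: le_trans (Dsep x y) _.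
  have -> : lp_dist p (f x) (f y) = r * lp_dist p (s x) (s y).
    rewrite /lp_dist (_ : (fun i => f x i - f y i) =
       fun i => r * (s x i - s y i)); last first.
      apply/funext => i; rewrite /s (hL _ _ Lxy) -mulrBr mulrA divff ?gt_eqF//.
      by rewrite mul1r; ring.
    rewrite lp_powZ powRM ?powR_ge0 ?lp_pow_ge0// -powRrM divff ?gt_eqF//.
    by rewrite powRr1 (gtr0_norm r0)// ltW.
  have -> : 288 * p * Num.sqrt (ln n%:R) / r * (r * lp_dist p (s x) (s y)) =
      288 * Num.sqrt (ln n%:R) * (p * lp_dist p (s x) (s y)).
    by field; rewrite gt_eqF.
  apply: ler_wpM2l; first exact: mulr_ge0 (ler0n _ _) (sqrtr_ge0 _).
  have := @mazur_sum_lipschitz p2 _ _ _ (s1 x) (s1 y).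
  rewrite -ler_sqrt ?sqr_ge0// sqrtr_sqr ger0_norm//.
  by rewrite mulr_ge0 ?lp_dist_ge0// ltW.
Qed.

Lemma shrink_factor (p2 : 2 < p) :
  0 < (3 / 4) `^ p^-1 < 1 /\ 1 <= 5 * p * (1 - (3 / 4) `^ p^-1).
Proof.
have p0 : 0 < p by lra.
set t := _ `^ _; have t0 : 0 < t by rewrite powR_gt0//; lra.
suff h : t * (1 + 1 / (4 * p)) <= 1.
  have e0 : 0 < 1 / (4 * p) by rewrite divr_gt0// mulr_gt0.
  have t1 : t < 1 by nra.
  rewrite t0 t1; split => //.
  have : (t * (1 + 1 / (4 * p))) * (4 * p) <= 1 * (4 * p).
    by rewrite ler_wpM2r// mulr_ge0// ltW.
  have -> : (t * (1 + 1 / (4 * p))) * (4 * p) = t * (4 * p + 1).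
    by field; rewrite gt_eqF.
  nra.
have ln34 : ln (3 / 4 : R) <= - (1 / 4).
  have -> : 3 / 4 = 1 + - (1 / 4) :> R by field.
  by apply: le_ln1Dx; lra.
have tE : t = expR (p^-1 * ln (3 / 4)) by rewrite /t /powR gt_eqF//; lra.
have y1 : 1 / (4 * p) <= - (p^-1 * ln (3 / 4)).
  have -> : 1 / (4 * p) = p^-1 * (1 / 4) by field; rewrite gt_eqF.
  by rewrite -mulrN ler_wpM2l ?invr_ge0 ?(ltW p0)//; lra.
apply: (@le_trans _ _ (t * expR (- (p^-1 * ln (3 / 4))))).
  rewrite ler_wpM2l ?(ltW t0)//; apply: le_trans (expR_ge1Dx _).
  by rewrite lerD2l.
by rewrite tE -expRD subrr expR0.
Qed.

(** Shrinking the clusters by the factor [(3 / 4) `^ p^-1], which is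
    [1 - Omega (1 / p)], at each step: the costs of the steps form a geometric
    series dominated by the last scale. *)
Lemma lp_multiscale (p2 : 2 < p) (T I : finType) (n : nat) (f : T -> I -> R)
    (k : nat) (rho : R) : (1 < n)%N -> (#|T| <= n)%N -> 0 < rho ->
  (forall x, lp_pow p (f x) <= (rho / ((3 / 4) `^ p^-1) ^+ k) `^ p) ->
  exists D : fdist R {ffun T -> nat}, [/\ is_dist D,
    (forall d, d \in D -> in_balls p f rho d.2) &
    forall x y, prob D (fun M => M x != M y) <=
      1440 * p ^+ 2 * Num.sqrt (ln n%:R) / rho * lp_dist p (f x) (f y)].
Proof.
have p0 : 0 < p by lra.
move=> n1 Tn; have [/andP[t0 t1]] := shrink_factor p2; set t := _ `^ _ => tp.
have S0 := sqrtr_ge0 (ln n%:R : R); set S := Num.sqrt _ in S0 *.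
have pS0 : 0 <= 1440 * p ^+ 2 * S
  by exact: mulr_ge0 (mulr_ge0 (ler0n _ _) (sqr_ge0 _)) S0.
have pS1 : 0 <= 288 * p * S.
  exact: mulr_ge0 (mulr_ge0 (ler0n _ _) (ltW p0)) S0.
elim: k => [|k IH] in rho *; move=> rho0 fr.
  exists [:: (1, [ffun=> 0%N])]; split.
  - split=> [d|]; first by rewrite inE => /eqP->.
    by rewrite expect_cons /expect big_nil /= mulr1 addr0.
  - move=> d; rewrite inE => /eqP-> /=; exists (fun _ _ => 0); split => // x.
    move: (fr x); rewrite expr0 divr1; apply: le_trans.
    by rewrite /lp_pow; under eq_bigr do rewrite subr0.
  - move=> x y; rewrite /prob !expect_cons /expect !big_nil /= !ffunE eqxx /=.
    rewrite mulr0 addr0.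
    exact: mulr_ge0 (divr_ge0 pS0 (ltW rho0)) (lp_dist_ge0 _ _).
have [||D1 [D1D D1b D1s]] := IH (rho / t).
- by rewrite divr_gt0.
- by move=> x; apply: le_trans (fr x) _; rewrite exprS invfM mulrA.
have r0 : 0 < rho / t by rewrite divr_gt0.
have /choice[K KP] : forall L : {ffun T -> nat}, exists D, in_balls p f (rho / t) L ->
   [/\ is_dist D, (forall d, d \in D -> in_balls p f rho (refine_label L d.2)) &
    forall x y, L x = L y -> prob D (fun M => M x != M y) <=
      288 * p * S / (rho / t) * lp_dist p (f x) (f y)].
  move=> L; have [Lb|nLb] := pselect (in_balls p f (rho / t) L); last by exists [::].
  have [D [DD Db Ds]] := in_balls_refine p2 n1 Tn r0 Lb.
  exists D => _; split => // d /Db.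
  by rewrite -/t mulrCA divff ?mulr1// gt_eqF.
exists (bind_dist D1 K (@refine_label T)); split.
- by apply: is_dist_bind => // d /D1b/KP[].
- move=> _ /mem_bind[d [e [dD eK ->]]] /=.
  by have /D1b/KP[_ + _] := dD; apply.
- move=> x y; rewrite /prob expect_bind.
  set A := 288 * p * S / (rho / t) * lp_dist p (f x) (f y).
  have A0 : 0 <= A.
    exact: mulr_ge0 (divr_ge0 pS1 (ltW r0)) (lp_dist_ge0 _ _).
  apply: (@le_trans _ _ (expect D1 (fun L => (L x != L y)%:R + A))).
    apply: le_expect => [d|d dD]; first by have [+ _] := D1D; apply.
    have [KD _ KS] := KP _ (D1b _ dD).
    have [Lxy|Lxy] := eqVneq (d.2 x) (d.2 y).
      rewrite add0r; apply: le_trans (KS _ _ Lxy); apply: le_expect.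
        by have [+ _] := KD.
      by move=> e _; rewrite refine_labelP Lxy eqxx.
    rewrite -[leLHS]addr0 lerD// -[leRHS](expect_cst 1 KD).
    apply: le_expect => [|e _]; first by have [+ _] := KD.
    by case: (_ != _); rewrite ?lexx ?ler01.
  rewrite expectD expect_cst//.
  have := D1s x y; rewrite -/(prob _ _) => D1s'.
  apply: le_trans (lerD D1s' (lexx A)) _; rewrite /A -mulrDl.
  apply: ler_wpM2r; first exact: lp_dist_ge0.
  have -> : 1440 * p ^+ 2 * S / (rho / t) + 288 * p * S / (rho / t) =
      (1440 * p ^+ 2 * S * t + 288 * p * S * t) / rho.
    by field; rewrite !gt_eqF.
  apply: ler_wpM2r; first by rewrite invr_ge0 ltW.
  (* [t + t * (1 - t) <= 1] *)
  have step : 288 * p * S * t * 1 <= 288 * p * S * t * (5 * p * (1 - t)).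
    exact: ler_wpM2l (mulr_ge0 pS1 (ltW t0)) _ _ tp.
  have t2 : t + t * (1 - t) <= 1.
    have -> : t + t * (1 - t) = 1 - (1 - t) ^+ 2 by ring.
    by rewrite gerBl sqr_ge0.
  have := ler_wpM2l pS0 t2.
  have -> : 1440 * p ^+ 2 * S * (t + t * (1 - t)) =
     1440 * p ^+ 2 * S * t + 288 * p * S * t * (5 * p * (1 - t)) by ring.
  rewrite !mulr1 in step *; apply: le_trans.
  by rewrite lerD2l.
Qed.

Lemma in_balls_dist (p2 : 2 < p) (T I : finType) (f : T -> I -> R) (r : R)
    (L : {ffun T -> nat}) x y : 0 <= r -> in_balls p f r L -> L x = L y ->
  lp_dist p (f x) (f y) <= 4 * r.
Proof.
have p0 : 0 < p by lra.
move=> r0 [h [hL hr]] Lxy; have r40 : 0 <= 4 * r by rewrite mulr_ge0.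
have -> : 4 * r = ((4 * r) `^ p) `^ p^-1.
  by rewrite -powRrM divff ?gt_eqF// powRr1.
apply: ge0_ler_powR; rewrite ?invr_ge0 ?nnegrE ?lp_pow_ge0 ?powR_ge0 ?(ltW p0)//.
have two : 2 <= 2 `^ p :> R by apply: le1r_powR; lra.
apply: (@le_trans _ _ (\sum_i 2 `^ p * (`|f x i - h x i| `^ p + `|f y i - h y i| `^ p))).
  apply: ler_sum => i _; rewrite -(hL _ _ Lxy).
  have -> : f x i - f y i = (f x i - h x i) - (f y i - h x i) by ring.
  set a := f x i - _; set b := f y i - _.
  have m0 : 0 <= Num.max `|a| `|b| by rewrite le_max normr_ge0.
  apply: (@le_trans _ _ ((2 * Num.max `|a| `|b|) `^ p)).
    apply: ge0_ler_powR; rewrite ?nnegrE ?(mulr_ge0 (ler0n _ 2) m0) ?(ltW p0)//.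
    apply: le_trans (ler_normB _ _) _.
    have : `|a| <= Num.max `|a| `|b| by rewrite le_max lexx.
    have : `|b| <= Num.max `|a| `|b| by rewrite le_max lexx orbT.
    lra.
  rewrite powRM// ler_wpM2l ?powR_ge0//.
  by case: (leP `|a| `|b|) => _; rewrite ?lerDl ?lerDr powR_ge0.
rewrite -mulr_sumr big_split/= powRM// (_ : 4 `^ p = 2 `^ p * 2 `^ p :> R); last first.
  by rewrite -powRM//; congr (_ `^ _); ring.
rewrite -mulrA ler_wpM2l ?powR_ge0//.
have := hr x; have := hr y; rewrite /lp_pow; have := powR_ge0 r p; nra.
Qed.

(** A finite subset of [l_p] has random partitions of any diameter that
    separate points at rate [O(p ^ 2 sqrt (ln n))]. *)
Lemma lp_separation (p2 : 2 < p) (T I : finType) (n : nat) (f : T -> I -> R)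
    (Delta : R) : (1 < n)%N -> (#|T| <= n)%N -> 0 < Delta ->
  exists D : fdist R {ffun T -> nat}, [/\ is_dist D,
    (forall d, d \in D -> forall x y, d.2 x = d.2 y ->
       lp_dist p (f x) (f y) <= Delta) &
    forall x y, prob D (fun M => M x != M y) <=
      5760 * p ^+ 2 * Num.sqrt (ln n%:R) / Delta * lp_dist p (f x) (f y)].
Proof.
have p0 : 0 < p by lra.
move=> n1 Tn Delta0; have [/andP[t0 t1] _] := shrink_factor p2.
have r0 : 0 < Delta / 4 by rewrite divr_gt0.
pose Z := \sum_x lp_pow p (f x) `^ p^-1.
have Z0 : 0 <= Z by apply: sumr_ge0 => x _; exact: powR_ge0.
have s0 : 0 < 1 - (3 / 4) `^ p^-1 by rewrite subr_gt0.
have s1 : 1 - (3 / 4) `^ p^-1 <= 1 by rewrite gerBl ltW.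
have e0 : 0 < Delta / 4 / (Z + 1) by rewrite divr_gt0// ltr_wpDl.
have [k] := small_expr s0 s1 e0; rewrite opprB addrCA subrr addr0 => kZ.
have tk0 : 0 < ((3 / 4) `^ p^-1) ^+ k by rewrite exprn_gt0.
have fk x : lp_pow p (f x) <= (Delta / 4 / ((3 / 4) `^ p^-1) ^+ k) `^ p.
  have -> : lp_pow p (f x) = (lp_pow p (f x) `^ p^-1) `^ p.
    by rewrite -powRrM mulVf ?gt_eqF// powRr1// lp_pow_ge0.
  apply: ge0_ler_powR; rewrite ?nnegrE ?powR_ge0 ?(ltW p0)//.
    by rewrite divr_ge0 ?(ltW r0) ?(ltW tk0).
  apply: (@le_trans _ _ (Z + 1)).
    rewrite /Z (bigD1 x)//= -addrA lerDl addr_ge0// sumr_ge0// => y _.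
    exact: powR_ge0.
  rewrite ler_pdivlMr//; move: kZ; rewrite ler_pdivlMr ?ltr_wpDl//.
  by rewrite mulrC.
have [D [DD Db Ds]] := lp_multiscale p2 n1 Tn r0 fk.
exists D; split; first exact: DD.
- move=> d /Db db x y dxy; have := in_balls_dist p2 (ltW r0) db dxy; lra.
- move=> x y; apply: le_trans (Ds x y) _.
  rewrite le_eqVlt; apply/orP; left; apply/eqP; field; rewrite gt_eqF//.
Qed.

End LpSeparation.

Local Open Scope classical_set_scope.
Local Open Scope ring_scope.

(** * Approximation by simple functions *)

Section SimpleApproximation.
Context d (T : measurableType d) (R : realType).
Variable mu : {measure set T -> \bar R}.

Import HBSimple HBNNSimple.

(** The positive and negative parts are approximated separately, so that the
    error never exceeds the function itself. *)
Lemma sfun_approx_pointwise (f : T -> R) : measurable_fun setT f ->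
  exists g : nat -> T -> R, [/\ forall n, measurable_fun setT (g n),
    forall n, finite_set (range (g n)),
    forall x, g^~ x @ \oo --> f x & forall n x, `|f x - g n x| <= `|f x|].
Proof.
move=> mf.
pose fp x := Num.max (f x) 0; pose fn x := Num.max (- f x) 0.
have mp : measurable_fun setT (EFin \o fp).
  by apply/measurable_EFinP; apply: measurable_maxr.
have mn : measurable_fun setT (EFin \o fn).
  by apply/measurable_EFinP; by apply: measurable_maxr => //; exact: measurable_funN.
have p0 x : setT x -> (0 <= (EFin \o fp) x)%E by rewrite lee_fin le_max lexx orbT.
have n0 x : setT x -> (0 <= (EFin \o fn) x)%E by rewrite lee_fin le_max lexx orbT.
pose P k := nnsfun_approx measurableT mp k.
pose N k := nnsfun_approx measurableT mn k.
have Pc x : (fun k => P k x) @ \oo --> fp x.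
  by have /fine_cvgP[_] := cvg_nnsfun_approx measurableT mp p0 (I : setT x).
have Nc x : (fun k => N k x) @ \oo --> fn x.
  by have /fine_cvgP[_] := cvg_nnsfun_approx measurableT mn n0 (I : setT x).
have PE k x : P k x <= fp x.
  by rewrite /P nnsfun_approxE -lee_fin; apply: (le_approx k p0).
have NE k x : N k x <= fn x.
  by rewrite /N nnsfun_approxE -lee_fin; apply: (le_approx k n0).
have fE x : f x = fp x - fn x.
  by rewrite /fp /fn; case: (leP (f x) 0); case: (leP (- f x) 0); lra.
exists (fun k x => P k x - N k x); split.
- by move=> k; apply: measurable_funB; exact: measurable_funPT.
- move=> k; apply: (@sub_finite_set _ _
    ([set a - b | a in range (P k) & b in range (N k)])).
    by move=> _ [x _ <-]; exists (P k x); [exists x|exists (N k x); [exists x|]].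
  by apply: finite_image2; exact: fimfunP.
- by move=> x; rewrite fE; exact: cvgB (Pc x) (Nc x).
- move=> k x.
  have := PE k x; have := NE k x.
  have : 0 <= P k x by exact: fun_ge0.
  have : 0 <= N k x by exact: fun_ge0.
  rewrite /fp /fn; move: (P k x) (N k x) => a b b0 a0.
  have [fx0|fx0] := leP 0 (f x).
    rewrite (@max_r _ _ (- f x)) ?oppr_le0// => b1 a1.
    rewrite !ger0_norm; lra.
  rewrite (@max_l _ _ (- f x)) ?oppr_ge0 ?(ltW fx0)//.
  move=> b1 a1; rewrite !ler0_norm; lra.
Qed.

(** Simple functions are dense in [L_p]. *)
Lemma simple_dense (p : R) (f : T -> R) (eps : R) : 0 < p ->
  measurable_fun setT f -> ('N[mu]_(p%:E) [EFin \o f] < +oo)%E -> 0 < eps ->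
  exists g : T -> R, [/\ measurable_fun setT g, finite_set (range g) &
    ('N[mu]_(p%:E) [EFin \o (f \- g)%R] <= eps%:E)%E].
Proof.
move=> p0 mf ff eps0; have [g [mg fg cg bg]] := sfun_approx_pointwise mf.
have mpow (h : T -> R) : measurable_fun setT h ->
    measurable_fun setT (fun x => (`|h x| `^ p)%:E).
  move=> mh; apply/measurable_EFinP.
  apply: (measurableT_comp (measurable_powR p)).
  exact: measurableT_comp.
have fint : mu.-integrable setT (fun x => (`|f x| `^ p)%:E).
  apply/integrableP; split; first exact: mpow.
  have := @poweR_lty R _ p ff; rewrite poweR_Lnorm ?gt_eqF//.
  apply: le_lt_trans; rewrite le_eqVlt; apply/orP; left; apply/eqP.
  by apply: eq_integral => x _ /=; rewrite ger0_norm ?powR_ge0.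
have cvg0 x : (fun n => (`|f x - g n x| `^ p)%:E) @ \oo --> (0 : R)%:E.
  apply: cvg_EFin; first exact: nearW.
  apply/cvgr0Pnorm_lt => e e0.
  have e1 : 0 < e `^ p^-1 by rewrite powR_gt0.
  have /cvgrPdist_lt/(_ _ e1) := cg x; apply: filterS => n /= fg_lt.
  rewrite ger0_norm ?powR_ge0// (_ : e = (e `^ p^-1) `^ p); last first.
    by rewrite -powRrM mulVf ?gt_eqF// powRr1// ltW.
  by apply: gt0_ltr_powR; rewrite ?nnegrE ?powR_ge0.
have [|||||_ + _] := @dominated_convergence _ _ _ mu setT measurableT
  (fun n x => (`|f x - g n x| `^ p)%:E) (cst 0%E) (fun x => (`|f x| `^ p)%:E) _ _ _ _ _.
- by move=> n; apply: (mpow (fun x => f x - g n x)); exact: measurable_funB.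
- exact: measurable_cst.
- by apply: aeW => x _; exact: cvg0.
- exact: fint.
- apply: aeW => x n _; rewrite /= ger0_norm ?powR_ge0// lee_fin.
  by apply: ge0_ler_powR; rewrite ?nnegrE ?(ltW p0).
move=> /fine_cvgP[fin] /cvgr0Pnorm_lt => /(_ (eps `^ p)).
rewrite powR_gt0// => /(_ isT) small.
have [n [/= nfin nsmall]] := @filter_ex _ _ (eventually_filter) _ (filterI fin small).
exists (g n); split => //.
rewrite unlock.
have -> : eps%:E = ((eps `^ p)%:E `^ p^-1)%E.
  by rewrite poweR_EFin -powRrM divff ?gt_eqF// powRr1// ltW.
set J := (\int[mu]_x _)%E; have J0 : (0 <= J)%E.
  by apply: integral_ge0 => x _; exact: poweR_ge0.
apply: gt0_ler_poweR; rewrite ?invr_ge0 ?(ltW p0) ?in_itv/= ?J0 ?leey ?lee_fin ?powR_ge0//.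
have JE : J = (\int[mu]_x `|(`|f x - g n x| `^ p)%:E - 0|)%E.
  by apply: eq_integral => x _ /=; rewrite subr0 [in RHS]ger0_norm ?powR_ge0.
move: nfin nsmall; rewrite /= -JE => Jfin.
rewrite -(fineK Jfin) lee_fin => /ltW; apply: le_trans; exact: ler_norm.
Qed.

Lemma sum_disjoint_indic (I : finType) (A : I -> set T) (v : I -> R) x k :
  (forall k l y, A k y -> A l y -> k = l) -> A k x ->
  \sum_l v l * \1_(A l) x = v k.
Proof.
move=> Adisj Akx; rewrite (bigD1 k)//= indicE mem_set// mulr1 big1 ?addr0// => l lk.
rewrite indicE memNset ?mulr0// => Alx.
by move: lk; rewrite (Adisj _ _ _ Alx Akx) eqxx.
Qed.

Lemma Lnorm_step (p : R) (I : finType) (A : I -> set T) (v : I -> R) (h : T -> R) :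
  0 < p -> (mu setT < +oo)%E -> (forall k, measurable (A k)) ->
  (forall k l x, A k x -> A l x -> k = l) ->
  (forall x, h x = \sum_k v k * \1_(A k) x) ->
  ('N[mu]_(p%:E) [EFin \o h])%E =
  ((\sum_k `|v k| `^ p * fine (mu (A k))) `^ p^-1)%:E.
Proof.
move=> p0 mufin mA Adisj hE; rewrite unlock -poweR_EFin; congr (_ `^ _)%E.
transitivity (\int[mu]_x (\sum_k (`|v k| `^ p)%:E * (\1_(A k) x)%:E))%E.
  apply: eq_integral => x _; rewrite /= hE.
  under [RHS]eq_bigr do rewrite -EFinM.
  rewrite sumEFin; congr (_%:E).
  have [[k Akx]|nA] := pselect (exists k, A k x).
    by rewrite !(sum_disjoint_indic _ Adisj Akx).
  rewrite !big1 ?normr0 ?powR0 ?gt_eqF// => k _; rewrite indicE memNset ?mulr0//.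
    by move=> Akx; apply: nA; exists k.
  by move=> Akx; apply: nA; exists k.
rewrite ge0_integral_sum//.
- rewrite -sumEFin; apply: eq_bigr => k _; rewrite ge0_integralZl//.
  + rewrite integral_indic// setIT EFinM fineK// ge0_fin_numE//.
    by apply: le_lt_trans mufin; rewrite le_measure ?inE.
  + by apply/measurable_EFinP; exact: measurable_indic.
- move=> k; apply/measurable_EFinP; apply: measurable_funM => //.
Qed.

(** Finitely many simple functions over a finite measure span a copy of a
    finite-dimensional [l_p]. *)
Lemma simple_lp (p : R) (n : nat) (g : 'I_n -> T -> R) :
  0 < p -> (mu setT < +oo)%E -> (forall a, measurable_fun setT (g a)) ->
  (forall a, finite_set (range (g a))) ->
  exists (I : finType) (v : 'I_n -> I -> R), forall a b,
    ('N[mu]_(p%:E) [EFin \o (g a \- g b)%R])%E = (lp_dist p (v a) (v b))%:E.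
Proof.
move=> p0 mufin mg fg.
have /choice[s sP] : forall a, exists s : seq R, range (g a) = [set` s].
  by move=> a; exact/finite_seqP.
pose S := flatten [seq s a | a <- enum 'I_n].
have gS a x : g a x \in S.
  apply/flattenP; exists (s a); first by apply: map_f; rewrite mem_enum.
  have gax : range (g a) (g a x) by exists x.
  by move: gax; rewrite sP.
pose I := {ffun 'I_n -> seq_sub S} : finType.
pose A (k : I) := [set x | forall a, g a x = ssval (k a)].
pose v a (k : I) := ssval (k a) * (fine (mu (A k))) `^ p^-1.
exists I, v => a b.
rewrite (@Lnorm_step p I A (fun k => ssval (k a) - ssval (k b)))//.
- congr (_%:E); rewrite /lp_dist /lp_pow; congr (_ `^ _); apply: eq_bigr => k _.
  rewrite /v -mulrBl normrM powRM// [in RHS](ger0_norm (powR_ge0 _ _)) -powRrM.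
  by rewrite mulVf ?gt_eqF// powRr1// fine_ge0.
- move=> k; have -> : A k = \bigcap_(a in [set: 'I_n]) (g a @^-1` [set ssval (k a)]).
    by apply/seteqP; split => x Akx c; [move=> _|]; exact: Akx.
  apply: fin_bigcap_measurable => // c _; rewrite -[X in measurable X]setTI.
  exact: mg.
- move=> k l x Ak Al; apply/ffunP => c; apply: val_inj.
  by rewrite /= -Ak -Al.
- move=> x; pose k : I := [ffun a => SeqSub (gS a x)].
  have Ak : A k x by move=> c; rewrite ffunE.
  rewrite (sum_disjoint_indic _ _ Ak) /= ?ffunE//.
  by move=> k' l y Ak' Al; apply/ffunP => c; apply: val_inj; rewrite /= -Ak' -Al.
Qed.

End SimpleApproximation.

(** * From labellings to random partitions *)

Section Clusters.
Context {R : realType} {M : metricType R}.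

Lemma cluster_ofP (Q : set (set M)) x : is_partition Q ->
  Q (cluster_of Q x) /\ cluster_of Q x x.
Proof.
move=> [Qcov _]; have : cover Q id x by rewrite Qcov.
move=> [A QA Ax]; exact: (@getPex _ [set B | Q B /\ B x] (ex_intro _ A (conj QA Ax))).
Qed.

Lemma cluster_of_eq (Q : set (set M)) (A : set M) x : is_partition Q ->
  Q A -> A x -> cluster_of Q x = A.
Proof.
move=> Qp QA Ax; have [QC Cx] := cluster_ofP x Qp; have [_ Qtriv] := Qp.
by apply: (Qtriv _ _ QC QA); exists x.
Qed.

Lemma cluster_of_same (Q : set (set M)) x y : is_partition Q ->
  cluster_of Q x = cluster_of Q y <-> exists A, [/\ Q A, A x & A y].
Proof.
move=> Qp; split=> [xy|[A [QA Ax Ay]]]; last by rewrite !(cluster_of_eq Qp QA).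
have [QC Cx] := cluster_ofP x Qp; exists (cluster_of Q x); split => //.
by rewrite xy; exact: (cluster_ofP y Qp).2.
Qed.

End Clusters.

Section IndexLaw.
Context {R : realType} (T : finType) (D : fdist R {ffun T -> nat}).

(** The outcome at position [i] in the list [D]; past the end of the list, the
    first one. *)
Definition outcome (i : nat) : R * {ffun T -> nat} :=
  nth (head (0, [ffun=> 0%N]) D) D i.

Lemma outcome_in i : is_dist D -> outcome i \in D.
Proof.
move=> [_ D1]; have D0 : D != [::].
  apply/eqP => D0; move: D1; rewrite D0 /expect big_nil => /eqP.
  by rewrite eq_sym oner_eq0.
have [iD|iD] := ltnP i (size D); first exact: mem_nth.
by rewrite /outcome nth_default//; case: (D) D0 => //= d D' _; rewrite inE eqxx.
Qed.


(** The law on [nat] of the position of an outcome in the list [D]. *)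
Definition index_law : set nat -> \bar R :=
  msum (fun i => mscale `|(outcome i).1|%:nng (dirac i)) (size D).

HB.instance Definition _ := Measure.on index_law.

Lemma index_lawE (P : pred {ffun T -> nat}) : is_dist D ->
  index_law [set i | P (outcome i).2] = (prob D P)%:E.
Proof.
move=> [D0 _]; rewrite /index_law /msum /prob /expect.
rewrite (big_nth (head (0, [ffun=> 0%N]) D)) big_mkord -sumEFin; apply: eq_bigr => i _.
transitivity (`|(outcome i).1|%:E * (\1_[set k | P (outcome k).2] (i : nat))%:E)%E.
  by [].
rewrite indicE mem_setE EFinM ger0_norm//; apply: D0; exact: mem_nth.
Qed.

End IndexLaw.

(** A bound on the separation modulus from finitely supported random labellings
    of (an image of) the space. *)
Lemma SEP_le_labels {R : realType} (M : metricType R) (T : finType) (iota : M -> T)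
    (s : R) : 0 <= s ->
  (forall Delta, 0 < Delta -> exists D : fdist R {ffun T -> nat}, [/\ is_dist D,
    (forall d, d \in D -> forall x y, d.2 (iota x) = d.2 (iota y) ->
       mdist x y <= Delta) &
    forall x y, prob D (fun L => L (iota x) != L (iota y)) <=
      s / Delta * mdist x y]) ->
  (SEP M <= s%:E)%E.
Proof.
move=> s0 H; apply: ereal_inf_lbound; exists s => //; split => // Delta Delta0.
have [D [DD Dbd Dsep]] := H _ Delta0.
have PT : index_law D setT = 1%E.
  rewrite -[1%E]/(1%:E) -[1](expect_cst 1 DD).
  by rewrite -(index_lawE (fun=> true) DD); congr (index_law D _); apply/seteqP.
pose P : probability nat R := HB.pack (index_law D)
  (Measure_isProbability.Build _ _ _ (index_law D) PT).
pose Gamma (i : nat) (w : nat) : set M := [set x | (outcome D w).2 (iota x) = i].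
have part w : is_partition (partition_at Gamma w).
  split; first by apply/seteqP; split=> // x _; exists (Gamma ((outcome D w).2 (iota x)) w) => //; exists ((outcome D w).2 (iota x)).
  by move=> _ _ [i _ <-] [j _ <-] [x [<- <-]].
have same w x y : cluster_of (partition_at Gamma w) x =
    cluster_of (partition_at Gamma w) y <-> (outcome D w).2 (iota x) = (outcome D w).2 (iota y).
  rewrite cluster_of_same//; split=> [[_ [[i _ <-]] -> ->//]|xy].
  by exists (Gamma ((outcome D w).2 (iota x)) w); split => //; exists ((outcome D w).2 (iota x)).
exists _, nat, P, Gamma; split.
- by split => // i E _.
- move=> w x; apply: ge_ereal_sup => _ [y yx [z zx <-]]; rewrite lee_fin.
  apply: (Dbd (outcome D w)); first exact: outcome_in.
  have [[i _ xE] _] := cluster_ofP x (part w).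
  by move: yx zx; rewrite -xE /Gamma /= => -> ->.
- move=> x y; rewrite (_ : [set w | _] = [set w | (outcome D w).2 (iota x) !=
      (outcome D w).2 (iota y)]); last first.
    apply/seteqP; split=> w /=.
      by move=> nsame; apply/eqP => /same.
    by move=> /eqP nsame /same.
  rewrite [P _](index_lawE (fun L => L (iota x) != L (iota y)) DD) lee_fin.
  exact: Dsep.
Qed.

(** * The upper bound *)

Lemma leb01_finite (R : realType) : (leb01 R [set: measurableTypeR R] < +oo)%E.
Proof.
rewrite /leb01 /mrestr setTI lebesgue_measure_itv /= lte_fin ltr01.
by rewrite oppr0 adde0 ltry.
Qed.

(** Finitely many points of [L_p] embed into a finite-dimensional [l_p] with
    distances distorted by a factor at most [2]. *)
Lemma Lp_finite_dimensional (R : realType) (p : R) (p1 : (1 <= p%:E)%E) (n : nat)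
    (f : 'I_n -> Lp p1) :
  exists (I : finType) (v : 'I_n -> I -> R), forall a b,
    mdist (f a) (f b) <= 2 * lp_dist p (v a) (v b) /\
    lp_dist p (v a) (v b) <= 2 * mdist (f a) (f b).
Proof.
have p0 : 0 < p by rewrite -lte_fin (lt_le_trans _ p1)// lte01.
pose dist a b := Lp_dist (f a) (f b).
have dist0 a b : 0 <= dist a b by exact: (mdist_ge0 (f a) (f b)).
(* a positive number at most a quarter of every positive distance *)
pose eps := (4 * (1 + \sum_a \sum_b (dist a b)^-1))^-1.
have sum0 : 0 <= \sum_a \sum_b (dist a b)^-1.
  by apply: sumr_ge0 => a _; apply: sumr_ge0 => b _; rewrite invr_ge0.
have eps0 : 0 < eps by rewrite invr_gt0 mulr_gt0// ltr_wpDr.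
have epsd a b : dist a b != 0 -> 4 * eps <= dist a b.
  move=> d0; have d1 : 0 < dist a b by rewrite lt_def d0 dist0.
  have dS : (dist a b)^-1 <= \sum_a \sum_b (dist a b)^-1.
    rewrite (bigD1 a)//= (bigD1 b)//= -addrA lerDl addr_ge0 ?sumr_ge0// => i _.
      by rewrite invr_ge0.
    by apply: sumr_ge0 => j _; rewrite invr_ge0.
  rewrite /eps invfM mulrA divff// mul1r -[leRHS]invrK.
  by rewrite lef_pV2 ?posrE ?invr_gt0 ?ltr_wpDr//; lra.
have /choice[G GP] : forall F : Lp p1, exists g : R -> R,
    [/\ measurable_fun [set: measurableTypeR R] g, finite_set (range g) &
    ('N[leb01 R]_(p%:E) [EFin \o (Lp_fun F \- g)%R] <= eps%:E)%E].
  move=> F; apply: (simple_dense (T := measurableTypeR R)) => //.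
    exact: measurable_Lp_fun.
  exact: (@Lebesgue_finite _ _ _ _ _ _ F).
have [I [v vE]] := @simple_lp _ (measurableTypeR R) R (leb01 R) p n (fun a => G (f a))
  p0 (leb01_finite R)
  (fun a => let: And3 h _ _ := GP (f a) in h) (fun a => let: And3 _ h _ := GP (f a) in h).
exists I, v => a b.
pose N (h : R -> R) := ('N[leb01 R]_(p%:E) [EFin \o h])%E.
have mF a' : measurable_fun [set: measurableTypeR R] (Lp_fun (f a')).
  exact: measurable_Lp_fun.
have mG a' : measurable_fun [set: measurableTypeR R] (G (f a')).
  by have [] := GP (f a').
have tri (h k : R -> R) : measurable_fun [set: measurableTypeR R] h ->
    measurable_fun [set: measurableTypeR R] k -> (N (h \+ k)%R <= N h + N k)%E.
  by move=> mh mk; apply: eminkowski.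
have NF : N (Lp_fun (f a) \- Lp_fun (f b)) = (dist a b)%:E by rewrite /dist Lp_distE.
have NG : N (G (f a) \- G (f b)) = (lp_dist p (v a) (v b))%:E by exact: vE.
have NFG a' : (N (Lp_fun (f a') \- G (f a'))%R <= eps%:E)%E by have [] := GP (f a').
have NGF a' : (N (G (f a') \- Lp_fun (f a'))%R <= eps%:E)%E.
  apply: le_trans (NFG a'); rewrite /N -oppe_Lnorm le_eqVlt; apply/orP; left; apply/eqP.
  by apply: eq_Lnorm => x /=; rewrite opprB.
have up1 : dist a b <= eps + (lp_dist p (v a) (v b) + eps).
  rewrite -lee_fin !EFinD -NF -NG.
  have -> : (Lp_fun (f a) \- Lp_fun (f b)) = (Lp_fun (f a) \- G (f a)) \+
      ((G (f a) \- G (f b)) \+ (G (f b) \- Lp_fun (f b))).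
    by apply/funext => x /=; ring.
  have mYXY : measurable_fun [set: measurableTypeR R]
      ((G (f a) \- G (f b)) \+ (G (f b) \- Lp_fun (f b))) by apply: measurable_funD; exact: measurable_funB.
  apply: le_trans (tri _ _ (measurable_funB (mF a) (mG a)) mYXY) _.
  apply: leeD => //.
  apply: le_trans (tri _ _ (measurable_funB (mG a) (mG b)) (measurable_funB (mG b) (mF b))) _.
  by apply: leeD.
have up2 : lp_dist p (v a) (v b) <= eps + (dist a b + eps).
  rewrite -lee_fin !EFinD -NF -NG.
  have -> : (G (f a) \- G (f b)) = (G (f a) \- Lp_fun (f a)) \+
      ((Lp_fun (f a) \- Lp_fun (f b)) \+ (Lp_fun (f b) \- G (f b))).
    by apply/funext => x /=; ring.
  have mYXY : measurable_fun [set: measurableTypeR R]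
      ((Lp_fun (f a) \- Lp_fun (f b)) \+ (Lp_fun (f b) \- G (f b))) by apply: measurable_funD; exact: measurable_funB.
  apply: le_trans (tri _ _ (measurable_funB (mG a) (mF a)) mYXY) _.
  apply: leeD => //.
  apply: le_trans (tri _ _ (measurable_funB (mF a) (mF b)) (measurable_funB (mF b) (mG b))) _.
  by apply: leeD.
rewrite -[mdist _ _]/(dist a b).
have [d0|d0] := eqVneq (dist a b) 0.
  have fab : f a = f b by exact: Lp_dist_positivity d0.
  have : N (G (f a) \- G (f b)) = 0%E.
    rewrite /N fab (_ : EFin \o _ = cst 0%E) ?Lnorm0// ?gt_eqF//.
    by apply/funext => x /=; rewrite subrr.
  by rewrite NG => -[->]; rewrite d0 mulr0.
have := epsd _ _ d0; lra.
Qed.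

(** A factor [2] from the scale and a factor [2] from the distances. *)
Lemma rescale_rate (R : realType) (c Delta l m : R) : 0 <= c -> 0 < Delta ->
  l <= 2 * m -> c / (Delta / 2) * l <= 4 * c / Delta * m.
Proof.
move=> c0 Delta0 lm.
have -> : c / (Delta / 2) * l = (2 * c / Delta) * l by field; rewrite gt_eqF.
have -> : 4 * c / Delta * m = (2 * c / Delta) * (2 * m) by field; rewrite gt_eqF.
by apply: ler_wpM2l lm; rewrite divr_ge0 ?mulr_ge0 ?(ltW Delta0).
Qed.

(** A space whose image in [l_p] distorts distances by a factor at most [2]
    inherits the bound of [lp_separation]. *)
Lemma SEP_le_lp (R : realType) (p : R) (M : metricType R) (T I : finType)
    (n : nat) (iota : M -> T) (v : T -> I -> R) :
  2 < p -> (1 < n)%N -> (#|T| <= n)%N ->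
  (forall x y, mdist x y <= 2 * lp_dist p (v (iota x)) (v (iota y)) /\
    lp_dist p (v (iota x)) (v (iota y)) <= 2 * mdist x y) ->
  (SEP M <= (4 * (5760 * p ^+ 2 * Num.sqrt (ln n%:R)))%:E)%E.
Proof.
move=> p2 n1 Tn vE.
have s0 : 0 <= 5760 * p ^+ 2 * Num.sqrt (ln n%:R : R).
  apply: mulr_ge0 (sqrtr_ge0 _); apply: mulr_ge0 (sqr_ge0 _); exact: ler0n.
apply: (@SEP_le_labels _ M _ iota) => [|Delta Delta0].
  exact: mulr_ge0 (ler0n _ 4) s0.
have D20 : 0 < Delta / 2 by rewrite divr_gt0.
have [D [DD Db Ds]] := lp_separation p2 v n1 Tn D20.
exists D; split.
- exact: DD.
- move=> d dD x y /(Db _ dD) h; apply: le_trans (vE x y).1 _.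
  by rewrite mulrC -ler_pdivlMr.
- move=> x y; apply: le_trans (Ds (iota x) (iota y)) _.
  exact: rescale_rate s0 Delta0 (vE x y).2.
Qed.

Lemma SEP_subset_Lp (R : realType) (p : R) (p1 : (1 <= p%:E)%E) (p2 : 2 < p) (n : nat)
    (C : set (Lp p1)) : (0 < n)%N -> (C #<= `I_n)%card ->
  (SEP (set_type C) <= (4 * (5760 * p ^+ 2 * Num.sqrt (ln n%:R)))%:E)%E.
Proof.
move=> n0 /card_leP[phi].
have s0 : 0 <= 4 * (5760 * p ^+ 2 * Num.sqrt (ln n%:R : R)).
  apply: mulr_ge0 (ler0n _ 4) _.
  apply: mulr_ge0 (sqrtr_ge0 _); apply: mulr_ge0 (sqr_ge0 _); exact: ler0n.
have phi_lt (c : C) : (set_val (phi c) < n)%N by have := set_valP (phi c).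
pose iota (c : C) : 'I_n := Ordinal (phi_lt c).
have iota_inj : injective iota.
  move=> c c' /(congr1 val) /= /val_inj; apply: inj; by rewrite inE.
have [n1|n1] := ltnP 1 n; last first.
  (* the subset has at most one point, and the bound is [0] *)
  have C1 (x y : set_type C) : x = y.
    apply: iota_inj; apply: val_inj => /=.
    have x0 : (set_val (phi x) < 1)%N by exact: leq_trans (phi_lt x) n1.
    have y0 : (set_val (phi y) < 1)%N by exact: leq_trans (phi_lt y) n1.
    by move: x0 y0; rewrite !ltnS !leqn0 => /eqP -> /eqP ->.
  apply: (@SEP_le_labels _ (set_type C) _ iota) => // Delta Delta0.
  exists [:: (1, [ffun=> 0%N])]; split.
  - split=> [d|]; first by rewrite inE => /eqP->.
    by rewrite expect_cons /expect big_nil /= mulr1 addr0.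
  - by move=> d _ x y _; rewrite (C1 x y) mdistxx ltW.
  - move=> x y; rewrite (C1 x y) mdistxx mulr0 /prob expect_cons /expect big_nil.
    by rewrite eqxx /= mulr0 addr0.
have [[c0 Cc0]|C0] := pselect (exists c, C c); last first.
  have nC (x : set_type C) : False by apply: C0; exists (val x); exact: set_valP.
  apply: (@SEP_le_labels _ (set_type C) _ iota) => // Delta Delta0.
  exists [:: (1, [ffun=> 0%N])]; split.
  - split=> [d|]; first by rewrite inE => /eqP->.
    by rewrite expect_cons /expect big_nil /= mulr1 addr0.
  - by move=> d _ x; have := nC x.
  - by move=> x; have := nC x.
have /choice[f fP] : forall i, exists F : Lp p1, forall c : C, iota c = i -> val c = F.
  move=> i; have [[c ci]|nc] := pselect (exists c, iota c = i).
    by exists (val c) => c' c'i; rewrite (iota_inj c' c)// ci.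
  by exists c0 => c ci; case: nc; exists c.
have mdE (x y : set_type C) : mdist x y = mdist (f (iota x)) (f (iota y)).
  by rewrite -(fP _ x erefl) -(fP _ y erefl).
have [I [v vE]] := Lp_finite_dimensional f.
have nT : (#|'I_n| <= n)%N by rewrite card_ord.
apply: (@SEP_le_lp R p (set_type C) _ I n iota v p2 n1 nT) => x y.
rewrite (mdE x y); exact: (vE (iota x) (iota y)).
Qed.

(** * The discrete cube *)

Section Cube.
Variable d : nat.
Local Notation cube := {ffun 'I_d -> bool}.

(** The neighbour of [a] along the edge of direction [i]. *)
Definition flip (i : 'I_d) (a : cube) : cube :=
  [ffun j => if j == i then ~~ a j else a j].

(** The number of coordinates at which [a] and [b] differ. *)
Definition hamming (a b : cube) : nat := (\sum_i (a i != b i))%N.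

Lemma flipK i : involutive (flip i).
Proof. by move=> a; apply/ffunP => j; rewrite !ffunE; case: eqP; rewrite ?negbK. Qed.

(** An equivalence relation whose classes have diameter at most [d / 4] keeps at
    most half of the directed edges.  Each class lies in a Hamming ball around one
    of its points, and every kept edge moves towards that point in exactly one
    of its two directions. *)
Lemma kept_edges (E : rel cube) : equivalence_rel E ->
  (forall a b, E a b -> (4 * hamming a b <= d)%N) ->
  (2 * (\sum_a \sum_i E a (flip i a)) <= #|{: cube}| * d)%N.
Proof.
move=> Eeq Ediam.
have Erefl a : E a a by have [] := Eeq a a a.
have Etr a b c : E a b -> E a c = E b c by move=> ab; have [_ ->] := Eeq a b c.
pose rep a := odflt a [pick b | E a b].
have repE a : E a (rep a).
  by rewrite /rep; case: pickP => //= /(_ a); rewrite Erefl.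
have rep_eq a b : E a b -> rep a = rep b.
  move=> ab; rewrite /rep (eq_pick (Etr _ _ ^~ ab)).
  by case: pickP => //= /(_ b); rewrite Erefl.
pose down := (\sum_a \sum_i (E a (flip i a) && (a i != rep a i)))%N.
have splitE : (\sum_a \sum_i E a (flip i a) = down +
    \sum_a \sum_i (E a (flip i a) && (a i == rep a i)))%N.
  rewrite -big_split; apply: eq_bigr => a _; rewrite -big_split; apply: eq_bigr => i _.
  by case: (E _ _); case: (_ == _).
have upE : (\sum_a \sum_i (E a (flip i a) && (a i == rep a i)) = down)%N.
  rewrite /down exchange_big [RHS]exchange_big; apply: eq_bigr => i _.
  rewrite (reindex_inj (inv_inj (flipK i))); apply: eq_bigr => a _ /=.
  rewrite flipK; have [Ea|nEa] := boolP (E a (flip i a)).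
    rewrite -(Etr _ _ _ Ea) Erefl -(rep_eq _ _ Ea) ffunE eqxx /=.
    by case: (a i); case: (rep a i).
  suff -> : E (flip i a) a = false by [].
  by apply: contraNF nEa => /Etr <-.
have downE : (4 * down <= #|{: cube}| * d)%N.
  rewrite /down big_distrr /= -sum_nat_const; apply: leq_sum => a _.
  apply: leq_trans (Ediam _ _ (repE a)); rewrite leq_mul2l /=.
  by apply: leq_sum => i _; case: (E _ _).
by rewrite splitE upE addnn -mul2n mulnA.
Qed.

End Cube.

Section CubeSeparation.
Context {R : realType} {M : metricType R}.

Lemma measurable_separated d (Omega : measurableType d) (Gamma : nat -> Omega -> set M)
    (x y : M) : random_partition Gamma ->
  measurable [set w | cluster_of (partition_at Gamma w) x <>
                      cluster_of (partition_at Gamma w) y].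
Proof.
move=> [Gm Gp].
have m1 i z : measurable [set w | Gamma i w z].
  rewrite (_ : [set w | _] = [set w | [set z] `&` Gamma i w !=set0]).
    apply: Gm; apply: accessible_closed_set1; apply: hausdorff_accessible; exact: metric_hausdorff.
  by apply/seteqP; split => w /=; [move=> h; exists z|move=> [_ [-> ]]].
rewrite (_ : [set w | _] = ~` (\bigcup_i ([set w | Gamma i w x] `&`
    [set w | Gamma i w y]))); last first.
  apply/seteqP; split => w /= h; contra: h.
    move=> [i _ [ix iy]]; apply/(cluster_of_same _ _ (Gp w)).
    by exists (Gamma i w); split => //; exists i.
  by move=> /(cluster_of_same _ _ (Gp w))[_ [[i _ <-] ix iy]]; exists i.
by apply: measurableC; apply: bigcupT_measurable => i; exact: measurableI.
Qed.

(** The expected number of cut edges is at least half of the number of edges, at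
    scale [sqrt d / 2]. *)
Lemma SEP_cube_lower (d : nat) (x : {ffun 'I_d -> bool} -> M) : (0 < d)%N ->
  (forall a i, mdist (x a) (x (flip i a)) <= 1) ->
  (forall a b (r : R), 0 < r -> mdist (x a) (x b) <= r -> (hamming a b)%:R <= r ^+ 2) ->
  ((Num.sqrt d%:R / 4)%:E <= SEP M)%E.
Proof.
move=> d0 edge far; apply: le_ereal_inf_tmp => _ [s [s0 sP] <-].
have dR : 0 < d%:R :> R by rewrite ltr0n.
have sd0 : 0 < Num.sqrt d%:R :> R by rewrite sqrtr_gt0.
pose Delta : R := Num.sqrt d%:R / 2.
have Delta0 : 0 < Delta by rewrite divr_gt0.
have [dsp [W [P [Gamma [Grp Gbd Gsep]]]]] := sP _ Delta0.
have [_ Gp] := Grp.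
pose cut a i := [set w | cluster_of (partition_at Gamma w) (x a) <>
                      cluster_of (partition_at Gamma w) (x (flip i a))].
have mcut a i : measurable (cut a i) by exact: measurable_separated.
pose N := #|{: {ffun 'I_d -> bool}}|.
have N0 : 0 < N%:R :> R.
  by rewrite ltr0n; apply/card_gt0P; exists [ffun=> true].
have cuts w : (N * d)%:R / 2 <= \sum_a \sum_i (\1_(cut a i) w : R).
  pose E a b := `[< cluster_of (partition_at Gamma w) (x a) =
                    cluster_of (partition_at Gamma w) (x b) >].
  have EE : equivalence_rel E.
    move=> a b c; split; first exact/asboolP.
    by move=> /asboolP ab; rewrite /E ab.
  have Ed a b : E a b -> (4 * hamming a b <= d)%N.
    move=> /asboolP ab; rewrite -(ler_nat R) natrM.
    have : mdist (x a) (x b) <= Delta.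
      rewrite -lee_fin; apply: le_trans (Gbd w (x a)); apply: ereal_sup_ubound.
      exists (x a); first exact: (cluster_ofP _ (Gp w)).2.
      by exists (x b) => //; rewrite ab; exact: (cluster_ofP _ (Gp w)).2.
    move=> /(far _ _ _ Delta0); rewrite /Delta exprMn sqr_sqrtr ?ler0n//; lra.
  have := kept_edges EE Ed; rewrite -/N -(ler_nat R) natrM natr_sum => kept.
  have -> : \sum_a \sum_i (\1_(cut a i) w : R) =
      \sum_a \sum_i (1 - (E a (flip i a))%:R).
    apply: eq_bigr => a _; apply: eq_bigr => i _; rewrite indicE /E.
    by case: asboolP => h; [rewrite memNset ?subrr// /cut /= => /(_ h)|
      rewrite mem_set ?subr0].
  have -> : \sum_a \sum_i (1 - (E a (flip i a))%:R) =
     (N * d)%:R - \sum_a (\sum_i E a (flip i a))%N%:R :> R.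
    under eq_bigr do rewrite sumrB sumr_const card_ord -natr_sum.
    by rewrite sumrB sumr_const -mulrnA mulnC.
  lra.
have total : (N * d)%:R / 2 <= \sum_(a : {ffun 'I_d -> bool}) \sum_(i < d) s / Delta.
  rewrite -lee_fin; apply: (@le_trans _ _
     (\int[P]_w (\sum_a \sum_i (\1_(cut a i) w : R)%:E))%E).
    apply: (@le_trans _ _ (\int[P]_w ((N * d)%:R / 2)%:E)%E).
      have P1 : P setT = 1%E by exact: probability_setT.
      rewrite integral_cst; last exact: measurableT.
      by rewrite -[X in (_ * X)%E]/(P setT) P1 mule1.
    apply: ge0_le_integral => //.
    - apply: emeasurable_sum => a; apply: emeasurable_sum => i.
      by apply/measurable_EFinP; exact: measurable_indic.
    - move=> w _; under eq_bigr do rewrite sumEFin.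
      by rewrite sumEFin lee_fin.
  rewrite ge0_integral_sum//; last 2 first.
  - move=> a; apply: emeasurable_sum => i.
    by apply/measurable_EFinP; exact: measurable_indic.
  - by move=> a w _; apply: sume_ge0 => i _; rewrite lee_fin.
  rewrite -sumEFin; apply: lee_sum => a _.
  rewrite ge0_integral_sum//; last first.
    by move=> i; apply/measurable_EFinP; exact: measurable_indic.
  rewrite -sumEFin; apply: lee_sum => i _.
  rewrite integral_indic// setIT; apply: le_trans (Gsep (x a) (x (flip i a))) _.
  by rewrite lee_fin ler_piMr// divr_ge0// ltW.
move: total; rewrite !sumr_const card_ord -mulrnA -/N mulnC -[leRHS]mulr_natl.
rewrite ler_pM2l; last by rewrite natrM mulr_gt0.
rewrite ler_pdivlMr// /Delta lee_fin; lra.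
Qed.

End CubeSeparation.

(** * Rademacher sums in [L_p] *)

Lemma Lnorm_ae_eq d (T : measurableType d) (R : realType)
    (mu : {measure set T -> \bar R}) (p : R) (f g : T -> R) :
  measurable_fun setT f -> measurable_fun setT g -> f = g %[ae mu] ->
  ('N[mu]_(p%:E) [EFin \o f])%E = ('N[mu]_(p%:E) [EFin \o g])%E.
Proof.
move=> mf mg fg; rewrite unlock; congr (_ `^ _)%E.
have mpow (h : T -> R) : measurable_fun setT h ->
    measurable_fun setT (fun x => (`|h x| `^ p)%:E).
  move=> mh; apply/measurable_EFinP.
  by apply: (measurableT_comp (measurable_powR p)); exact: measurableT_comp.
apply: ae_eq_integral => //; [exact: mpow|exact: mpow|].
by move: fg; apply: filterS => x fgx xT; rewrite /= fgx.
Qed.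

Section Representatives.
Context {R : realType} {p : R} (p1 : (1 <= p%:E)%E).
Local Notation T := (measurableTypeR R).

(** Every [p]-integrable function has a class in [L_p]. *)
Lemma Lp_of_fun (f : R -> R) : measurable_fun [set: T] f ->
  finite_norm (leb01 R) p%:E f -> exists F : Lp p1, Lp_fun F = f %[ae leb01 R].
Proof.
move=> mf ff.
pose f1 : {mfun T >-> T} := HB.pack (f : T -> T) (isMeasurableFun.Build _ _ T T f mf).
pose q : {mfun_ leb01 R, T >-> T} := (\pi_({mfun_ leb01 R, T >-> T}) f1)%qT.
have qE : (q : R -> R) = f %[ae leb01 R].
  have /eqmodP/asboolP : (repr q = f1 %[mod {mfun_ leb01 R, T >-> T}])%qT.
    by rewrite reprK.
  by [].
have qfin : finite_norm (leb01 R) p%:E (q : R -> R).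
  rewrite /finite_norm (@Lnorm_ae_eq _ T R (leb01 R) p _ _ _ mf qE)//.
  exact: (@measurable_funPT _ _ _ _ (repr q)).
pose F : Lp p1 := HB.pack q (isFinLebesgue.Build _ T R (leb01 R) p%:E p1 q qfin).
by exists F.
Qed.

Lemma Lp_dist_of_fun (F G : Lp p1) (f g : R -> R) :
  measurable_fun [set: T] f -> measurable_fun [set: T] g ->
  Lp_fun F = f %[ae leb01 R] -> Lp_fun G = g %[ae leb01 R] ->
  (Lp_dist F G)%:E = ('N[leb01 R]_(p%:E) [EFin \o (f \- g)%R])%E.
Proof.
move=> mf mg Ff Gg; rewrite Lp_distE; apply: (@Lnorm_ae_eq _ T R (leb01 R)).
- by apply: measurable_funB; exact: measurable_Lp_fun.
- exact: measurable_funB.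
- have ae_filter := @ae_filter_ringOfSetsType _ T R (leb01 R).
  by apply: filterS2 Ff Gg => x Fx Gx xT; rewrite /= Fx// Gx.
Qed.

End Representatives.

Section Rademacher.
Variables (R : realType) (d : nat).
Local Notation cube := {ffun 'I_d -> bool}.
Local Notation N := #|{: cube}|.

Definition bit_sign (b : bool) : R := if b then 1 else -1.

(** The Rademacher sum over the coordinates at which [a] is true, evaluated at
    the signs [e]. *)
Definition rademacher (a e : cube) : R := \sum_i (a i)%:R * bit_sign (e i).

Lemma rademacherB a b e :
  rademacher a e - rademacher b e = \sum_i ((a i)%:R - (b i)%:R) * bit_sign (e i).
Proof. by rewrite -sumrB; apply: eq_bigr => i _; rewrite mulrBl. Qed.

Lemma rademacher_flip a i e : `|rademacher a e - rademacher (flip i a) e| = 1.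
Proof.
rewrite rademacherB (bigD1 i)//= big1 ?addr0 => [|j ji]; last first.
  by rewrite ffunE (negbTE ji) subrr mul0r.
rewrite ffunE eqxx /bit_sign; case: (a i); case: (e i) => /=;
  by rewrite ?subr0 ?sub0r ?mulr1 ?mulrN1 ?normrN ?normr1.
Qed.

Lemma bit_sign_orthogonal (i j : 'I_d) :
  \sum_(e : cube) bit_sign (e i) * bit_sign (e j) = if i == j then N%:R else 0.
Proof.
have [->|ij] := eqVneq i j.
  rewrite (eq_bigr (fun=> 1)) ?sumr_const// => e _.
  by rewrite /bit_sign; case: (e j); rewrite ?mulr1// mulrNN mulr1.
set S := \sum_e _; suff : S = - S by lra.
rewrite /S {1}(reindex_inj (inv_inj (flipK i))) -sumrN; apply: eq_bigr => e _ /=.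
rewrite !ffunE eqxx [j == i]eq_sym (negbTE ij) -mulNr; congr (_ * _).
by rewrite /bit_sign; case: (e i) => /=; rewrite ?opprK.
Qed.

Lemma rademacher_sqr a b :
  \sum_e (rademacher a e - rademacher b e) ^+ 2 = N%:R * (hamming a b)%:R.
Proof.
pose z i : R := (a i)%:R - (b i)%:R.
transitivity (\sum_i \sum_j z i * z j * \sum_(e : cube) bit_sign (e i) * bit_sign (e j)).
  under eq_bigr => e _ do
    rewrite rademacherB expr2 mulr_suml; rewrite exchange_big.
  apply: eq_bigr => i _ /=.
  under eq_bigr => e _ do rewrite mulr_sumr; rewrite exchange_big.
  apply: eq_bigr => j _ /=; rewrite mulr_sumr; apply: eq_bigr => e _.
  by rewrite mulrACA.
rewrite /hamming natr_sum mulr_sumr; apply: eq_bigr => i _.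
rewrite [LHS](bigD1 i)//= [X in _ + X]big1 ?addr0 => [|j ji]; last first.
  by rewrite bit_sign_orthogonal eq_sym (negbTE ji) mulr0.
rewrite bit_sign_orthogonal eqxx mulrC; congr (_ * _); rewrite /z.
by case: (a i); case: (b i) => /=; rewrite ?subrr ?mulr0 ?subr0 ?mulr1// sub0r mulrNN mulr1.
Qed.

(** Monotonicity of power means. *)
Lemma mean_sqr_le (p : R) (I : finType) (u : I -> R) (r : R) : 2 < p -> 0 < r ->
  (0 < #|I|)%N -> \sum_i `|u i| `^ p * #|I|%:R^-1 <= r `^ p ->
  \sum_i u i ^+ 2 <= #|I|%:R * r ^+ 2.
Proof.
move=> p2 r0 I0 up; have p0 : 0 < p by lra.
have IR : 0 < #|I|%:R :> R by rewrite ltr0n.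
have {}up : \sum_i `|u i| `^ p <= #|I|%:R * r `^ p.
  by move: up; rewrite -mulr_suml ler_pdivrMr// mulrC.
have Y i : u i ^+ 2 <= r ^+ 2 * (2 / p * (`|u i| `^ p / r `^ p) + (p - 2) / p).
  have := @young_square R p p2 (`|u i| / r) 1; rewrite powR1 /= !mulr1.
  rewrite ler01 divr_ge0 ?(ltW r0)// => /(_ isT isT).
  rewrite powRM ?invr_ge0 ?(ltW r0)// exprMn real_normK ?num_real// exprVn.
  rewrite -(powR_inv1 (ltW r0)) powRAC powR_inv1 ?powR_ge0//.
  by rewrite ler_pdivrMr ?exprn_gt0// [leRHS]mulrC.
apply: le_trans (ler_sum _ (fun i _ => Y i)) _.
rewrite -mulr_sumr big_split/= sumr_const -mulr_sumr -mulr_suml mulrC.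
rewrite ler_wpM2r ?sqr_ge0//.
have : 2 / p * ((\sum_i `|u i| `^ p) / r `^ p) <= 2 / p * #|I|%:R.
  rewrite ler_wpM2l ?divr_ge0 ?(ltW p0)//.
  by rewrite ler_pdivrMr ?powR_gt0.
rewrite -[((p - 2) / p) *+ _]mulr_natr.
have -> : (p - 2) / p = 1 - 2 / p by field; rewrite gt_eqF.
lra.
Qed.

Lemma cube_in_Lp (p : R) (p1 : (1 <= p%:E)%E) : 2 < p ->
  exists F : cube -> Lp p1,
    (forall a i, mdist (F a) (F (flip i a)) <= 1) /\
    (forall a b (r : R), 0 < r -> mdist (F a) (F b) <= r ->
       (hamming a b)%:R <= r ^+ 2).
Proof.
move=> p2; have p0 : 0 < p by lra.
have N0 : (0 < N)%N by apply/card_gt0P; exists [ffun=> true].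
have NR : 0 < N%:R :> R by rewrite ltr0n.
pose A (e : cube) : set R :=
  `[(enum_rank e)%:R / N%:R, (enum_rank e).+1%:R / N%:R[%classic.
have mA e : measurable (A e : set (measurableTypeR R)) by exact: measurable_itv.
have Adisj (e e' : cube) x : A e x -> A e' x -> e = e'.
  rewrite /A /= !in_itv /= => /andP[x1 x2] /andP[x3 x4]; apply: enum_rank_inj.
  have := le_lt_trans x1 x4; have := le_lt_trans x3 x2.
  rewrite !ltr_pM2r ?invr_gt0// !ltr_nat !ltnS => h1 h2.
  by apply: val_inj; apply/eqP; rewrite eqn_leq h1 h2.
have muA e : leb01 R (A e) = (N%:R^-1)%:E.
  have A01 : A e `&` `[0, 1]%classic = A e.
    apply/seteqP; split => x; first by case.
    move=> Ax; split=> //; move: Ax; rewrite /A /= !in_itv /= => /andP[x1 x2].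
    rewrite (le_trans _ x1) ?divr_ge0//= ltW// (lt_le_trans x2)//.
    by rewrite ler_pdivrMr// mul1r ler_nat.
  rewrite /leb01 /mrestr A01 lebesgue_measure_itv /= lte_fin.
  rewrite ltr_pM2r ?invr_gt0// ltr_nat leqnn -EFinB -mulrBl.
  by rewrite -natrB ?leqnSn// subSnn mul1r.
(* the step function on [[0, 1]] taking the values of [v] on intervals of
   equal length *)
pose h (v : cube -> R) (x : R) : R := \sum_e v e * \1_(A e) x.
have mh v : measurable_fun [set: measurableTypeR R] (h v).
  apply: measurable_sum => e; apply: measurable_funM; [exact: measurable_cst|exact: measurable_indic (mA e)].
have hN v : ('N[leb01 R]_(p%:E) [EFin \o h v])%E =
    ((\sum_e `|v e| `^ p * N%:R^-1) `^ p^-1)%:E.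
  rewrite (@Lnorm_step _ (measurableTypeR R) R (leb01 R) p _ A v (h v) p0)//.
    congr ((_ `^ _)%:E); apply: eq_bigr => e _; congr (_ * _).
    exact: (congr1 fine (muA e)).
  exact: leb01_finite.
have /choice[F FE] : forall a, exists F : Lp p1, Lp_fun F = h (rademacher a) %[ae leb01 R].
  by move=> a; apply: Lp_of_fun (mh _) _; rewrite /finite_norm hN ltry.
have dE a b : mdist (F a) (F b) =
    (\sum_e `|rademacher a e - rademacher b e| `^ p * N%:R^-1) `^ p^-1.
  apply/EFin_inj; rewrite -[mdist _ _]/(Lp_dist (F a) (F b)).
  rewrite (Lp_dist_of_fun (mh _) (mh _) (FE a) (FE b)) -hN.
  congr (Lnorm _ _ _); apply/funext => x /=; rewrite /h -sumrB.
  by congr (_%:E); apply: eq_bigr => e _; rewrite mulrBl.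
exists F; split=> [a i|a b r r0].
  rewrite dE; under eq_bigr do rewrite rademacher_flip powR1 mul1r.
  by rewrite sumr_const -[X in X `^ _]mulr_natr mulVf ?gt_eqF// powR1.
rewrite dE => dr; rewrite -(ler_pM2l NR) -rademacher_sqr.
apply: (mean_sqr_le p2 r0 N0).
set S := \sum_e _ in dr *.
have S0 : 0 <= S by apply: sumr_ge0 => e _; rewrite mulr_ge0 ?powR_ge0.
have -> : S = (S `^ p^-1) `^ p by rewrite -powRrM mulVf ?gt_eqF// powRr1.
by apply: ge0_ler_powR; rewrite ?nnegrE ?powR_ge0 ?(ltW p0) ?(ltW r0).
Qed.

End Rademacher.

(** * The separation modulus of finite subsets of [L_p] *)

Lemma SEP_ge0 (R : realType) (M : metricType R) : (0 <= SEP M)%E.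
Proof.
by apply: le_ereal_inf_tmp => _ [s [s0 _] <-]; rewrite lee_fin.
Qed.

Lemma SEPn_ge (R : realType) (n : nat) (M : metricType R) (C : set M) :
  (C #<= `I_n)%card -> (SEP (set_type C) <= SEPn n M)%E.
Proof. by move=> Cn; apply: ereal_sup_ubound; exists C. Qed.

Lemma card_range_le (T : finType) (U : Type) (F : T -> U) (n : nat) :
  (#|T| <= n)%N -> (range F #<= `I_n)%card.
Proof.
move=> Tn; have TI : ([set: T] #<= `I_n)%card.
  apply/pcard_leP/injfunPex; exists (fun x => nat_of_ord (enum_rank x)).
    by move=> x _ /=; apply: leq_trans (ltn_ord _) Tn.
  by move=> x y _ _ /val_inj/enum_rank_inj.
exact: card_le_trans (card_image_le F [set: T]) TI.
Qed.

Lemma SEPn_Lp_lower (R : realType) (p : R) (p1 : (1 <= p%:E)%E) (n : nat) :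
  2 < p -> (0 < n)%N -> ((1 / 8 * Num.sqrt (ln n%:R))%:E <= SEPn n (Lp p1))%E.
Proof.
move=> p2 n0; have [n1|n1] := leqP n 1.
  have -> : n = 1%N by apply/eqP; rewrite eqn_leq n1 n0.
  rewrite ln1 sqrtr0 mulr0; apply: le_trans (SEP_ge0 _) (SEPn_ge (C := set0) _).
  exact: card_ge0.
pose d := trunc_log 2 n.
have d0 : (0 < d)%N by rewrite trunc_log_gt0.
have nd : (n < 2 ^ d.+1)%N by exact: trunc_log_ltn.
have dn : (2 ^ d <= n)%N by exact: trunc_logP.
have [F [Fedge Ffar]] := cube_in_Lp d p1 p2.
have Cn : (range F #<= `I_n)%card.
  by apply: card_range_le; rewrite card_ffun card_bool card_ord.
apply: le_trans (SEPn_ge Cn).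
pose x a : set_type (range F) := exist _ (F a) (mem_set (imageT F a)).
apply: le_trans (@SEP_cube_lower R (set_type (range F)) d x d0 Fedge Ffar).
rewrite lee_fin.
have ln_n : ln n%:R <= 4 * d%:R :> R.
  apply: (@le_trans _ _ (ln ((2 : R) ^+ d.+1))).
    by rewrite ler_ln ?posrE ?exprn_gt0 ?ltr0n// -natrX ler_nat ltnW.
  rewrite lnXn// -[leLHS]mulr_natr.
  have ln2 : ln (2 : R) <= 1 by have -> : 2 = 1 + 1 :> R by []; apply: le_ln1Dx; lra.
  have d1 : 1 <= d%:R :> R by rewrite ler1n.
  rewrite -natr1; nra.
have : Num.sqrt (ln n%:R) <= 2 * Num.sqrt (d%:R : R).
  have -> : 2 * Num.sqrt (d%:R : R) = Num.sqrt (2 ^+ 2 * d%:R).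
    by rewrite sqrtrM ?sqr_ge0// sqrtr_sqr ger0_norm.
  by apply: ler_wsqrtr; rewrite expr2; lra.
lra.
Qed.

Lemma SEPn_Lp_upper (R : realType) (p : R) (p1 : (1 <= p%:E)%E) (n : nat) :
  2 < p -> (0 < n)%N ->
  (SEPn n (Lp p1) <= (4 * (5760 * p ^+ 2 * Num.sqrt (ln n%:R)))%:E)%E.
Proof.
by move=> p2 n0; apply: ge_ereal_sup => _ [C Cn <-]; exact: SEP_subset_Lp.
Qed.

Theorem theorem1p10 (R : realType) :
  exists c C : R, 0 < c /\ 0 < C /\
    forall (p : R) (p2 : 2 < p) (n : nat), (0 < n)%N ->
      ((c * Num.sqrt (ln n%:R))%:E <= SEPn n (Lp (ge1_of_gt2 p2)))%E /\
      (SEPn n (Lp (ge1_of_gt2 p2)) <=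
         (C * p ^+ 2 * Num.sqrt (ln n%:R))%:E)%E.
Proof.
exists (1 / 8), (4 * 5760); split; first by rewrite divr_gt0.
split; first by apply: mulr_gt0; rewrite ltr0n.
move=> p p2 n n0; split; first exact: SEPn_Lp_lower.
by have := SEPn_Lp_upper (ge1_of_gt2 p2) p2 n0; rewrite !mulrA.
Qed.
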